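(* Let $k$ be a field of characteristic $0$, let $P$ be a locally finite poset viewed as a category, let $kP$ be its incidence algebra, and let $S\subseteq kP$ be the subalgebra generated by the identity morphisms in $P$. Let $\Phi: C^\bullet(P;k)\to C^\bullet(kP,S;kP)$ be defined by $$\Phi f=\sum_{i\in P} f(i)E^{ii}\quad\text{for } f\in C^0(P;k),$$ $$(\Phi f)(E^{i_0i_1},\ldots,E^{i_{n-1}i_n})=f(i_0,\ldots,i_n)E^{i_0i_n}\quad\text{for } f\in C^n(P;k),\ n>0.$$ Then $\Phi$ is an isomorphism of homotopy G-algebras (hG-algebras), where both sides carry the hG-algebra structure derived from their structure of operad with multiplication.
   Context: A poset $P$ is locally finite if $\{x\in P\mid x_1\le x\le x_2\}$ is finite for all $x_1,x_2\in P$. View $P$ as a category whose objects are the elements of $P$, with a unique morphism $E^{ij}$ from $i$ to $j$ whenever $i\le j$. The incidence algebra $kP$ is the category algebra of $P$ over $k$: its elements are formal sums $\sum_{i\le j} r_{ij}E^{ij}$ with $r_{ij}\in k$, and the product is defined on generators by $E^{ij}E^{jl}=E^{il}$ and $E^{ij}E^{i'l}=0$ for $j\neq i'$. $S$ is the subalgebra of $kP$ generated by the identity morphisms $E^{ii}$, $i\in P$. Operads are non-$\Sigma$ operads of $k$-vector spaces $\mathcal{O}(n)$, $n\ge 0$, with compositions $\gamma$ and identity $\mathrm{id}\in\mathcal{O}(1)$ satisfying the usual axioms. Simplicial cochains: $C^\bullet(P;k)$ is the simplicial cochain complex of the nerve of $P$; $C^n(P;k)$ is the space of $k$-valued functions on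 the $n$-simplices $(v_0,\ldots,v_n)$, $v_0\le\cdots\le v_n$, of the nerve. It is an operad, with identity the constant 1-cochain $1$, via, for $\varphi\in C^r$, $\varphi_i\in C^{n_i}$, $$\gamma(\varphi;\varphi_1,\ldots,\varphi_r)(v_0,\ldots,v_{n_1+\cdots+n_r})=\varphi(v_0,v_{n_1},v_{n_1+n_2},\ldots,v_{n_1+\cdots+n_r})\,\varphi_1(v_0,\ldots,v_{n_1})\,\varphi_2(v_{n_1},\ldots,v_{n_1+n_2})\cdots\varphi_r(v_{n_1+\cdots+n_{r-1}},\ldots,v_{n_1+\cdots+n_r}).$$ Its multiplication is the constant 2-cochain $m_{\mathrm S}=1$. Relative Hochschild cochains: for an associative unital $k$-algebra $A$ and a subalgebra $S$, $C^n(A,S;A)$, $n>0$, is the space of $k$-multilinear $f:A^n\to A$ with $f(ba_1,\ldots,a_n)=bf(a_1,\ldots,a_n)$, $f(\ldots,a_ib,a_{i+1},\ldots)=f(\ldots,a_i,ba_{i+1},\ldots)$ for $1\le i<n$, and $f(a_1,\ldots,a_nb)=f(a_1,\ldots,a_n)b$ for all $a_1,\ldots,a_n\in A$, $b\in S$; and $C^0(A,S;A)=\{a\in A\mid ab=ba \text{ for all } b\in S\}$. It is an operad under the usual composition of multilinear maps, with identity $\mathrm{id}_A$ and multiplication $m_{\mathrm H}(a_1,a_2)=a_1a_2$. In degree $n>0$, $\Phi f$ is specified by its values on composable tuples of morphisms ($i_0\le i_1\le\cdots\le i_n$) as displayed. hG-algebra of an operad with multiplication $(\mathcal{O},m)$: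 regard $\mathcal{O}=\bigoplus_n\mathcal{O}(n)$ as a graded vector space; for $x\in\mathcal{O}(n)$ write $|x|=n$ and let $sx\in\mathcal{O}[1]$ be the same element in degree $|sx|=n-1$; the symbol $s$ has degree $-1$. The braces on $\mathcal{O}[1]$ are $$sx\{sx_1,\ldots,sx_n\}=\sum_{\sigma\in\mathrm{Sh}_{n,|x|-n}}\kappa\, s\,\gamma\bigl(sx;\sigma(sx_1,\ldots,sx_n,s\,\mathrm{id},\ldots,s\,\mathrm{id})\bigr),$$ the sum over $(n,|x|-n)$-shuffles, i.e. over all ways to insert $x_1,\ldots,x_n$ in this order into inputs of $x$ with $\mathrm{id}$ in the other inputs, and $\kappa$ is the Koszul sign of the composite permutation $(sx_n,\ldots,sx_1,s,\ldots,s)\mapsto(sx_1,\ldots,sx_n,s,\ldots,s)\mapsto\sigma(sx_1,\ldots,sx_n,s,\ldots,s)$. Put $f\circ g=f\{g\}$. A multiplication is an element $m\in\mathcal{O}(2)[1]$ with $m\circ m=0$, and an operad with multiplication is an operad with a chosen multiplication. The dot product on $\mathcal{O}$ is $x\cdot y=(-1)^{|x|}s^{-1}(m\{sx,sy\})$. The differential on $\mathcal{O}[1]$ is $d(sx)=m\circ sx-(-1)^{|sx|}sx\circ m$, and the differential on $\mathcal{O}$ is determined by $d(sx)=-s\,dx$. The tuple ($\mathcal{O}$, braces, $\cdot$, $d$) is the hG-algebra derived from $(\mathcal{O},m)$. (It is known to satisfy the hG-algebra axioms: $(\mathcal{O},\cdot,d)$ is a differential graded associative algebra, $\mathcal{O}[1]$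 is a brace algebra, and the braces satisfy compatibility identities with $\cdot$ and $d$.) An isomorphism of hG-algebras is a degree-$0$ linear bijection compatible with all braces, the dot product and the differential.
   Formalization: Elements of kP are possibly infinite formal sums, and S is taken to be the subalgebra generated by the identity morphisms under formal sums as well (all diagonal sums of r_i E^ii); with only finite combinations Φ is not surjective for P = Z. For finite P nothing changes. *)

(* Defs.v *)
From HB Require Import structures.
From mathcomp Require Import all_boot all_order all_algebra.
From mathcomp Require Import finmap.
From mathcomp Require Import boolp classical_sets functions cardinality fsbigop.

Set Implicit Arguments.
Unset Strict Implicit.
Unset Printing Implicit Defensive.

Import Order.TTheory GRing.Theory.

Local Open Scope ring_scope.

(* Unital associative k-algebras.  The library's algType excludes the zero    *)
(* algebra, which is the incidence algebra of the empty poset.                *)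
Record algebra (k : pzRingType) := Algebra {
  alg_sort :> lmodType k;
  alg_one : alg_sort;
  alg_mul : alg_sort -> alg_sort -> alg_sort;
  alg_mulA : associative alg_mul;
  alg_mul1l : left_id alg_one alg_mul;
  alg_mul1r : right_id alg_one alg_mul;
  alg_mul_linearl : forall y, linear (fun x => alg_mul x y);
  alg_mul_linearr : forall x, linear (fun y => alg_mul x y)
}.

Definition cast_arity (k : pzRingType) (V : nat -> lmodType k) m n (e : m = n)
  (x : V m) : V n := ecast i (V i) e x.

Definition same_arity_eq (k : pzRingType) (V : nat -> lmodType k) m n
  (x : V m) (y : V n) : Prop := exists e : m = n, cast_arity e x = y.

(* In op_compA, tagnat.Rank i j : 'I_(\sum_i a i) is the position of the j-th *)
(* input of the i-th block.                                                   *)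
Record operad (k : pzRingType) := Operad {
  op_space :> nat -> lmodType k;
  op_id : op_space 1;
  op_comp : forall r (a : 'I_r -> nat), op_space r ->
    (forall i, op_space (a i)) -> op_space (\sum_(i < r) a i)%N;
  op_comp_linearl : forall r (a : 'I_r -> nat) (y : forall i, op_space (a i)),
    linear (fun x : op_space r => op_comp x y);
  op_comp_linearr : forall r (a : 'I_r -> nat) (x : op_space r)
      (y : forall i, op_space (a i)) (i : 'I_r),
    linear (fun z : op_space (a i) => op_comp x (dfwith y z));
  op_comp1l : forall n (x : op_space n),
    same_arity_eq (op_comp (a := fun _ : 'I_1 => n) op_id (fun=> x)) x;
  op_comp1r : forall n (x : op_space n),
    same_arity_eq (op_comp (a := fun _ : 'I_n => 1%N) x (fun=> op_id)) x;
  op_compA : forall r (a : 'I_r -> nat) (b : 'I_(\sum_(i < r) a i) -> nat)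
      (x : op_space r) (y : forall i, op_space (a i))
      (z : forall t, op_space (b t)),
    same_arity_eq
      (op_comp (op_comp x y) z)
      (op_comp x (fun i => op_comp (y i) (fun j => z (tagnat.Rank i j))))
}.

(* An (n, r - n)-shuffle is given by the increasing list h of the inputs that *)
(* receive x_1, ..., x_n; the other inputs receive id.                        *)
Definition increasing n r (h : {ffun 'I_n -> 'I_r}) : bool :=
  [forall i : 'I_n, forall j : 'I_n, (i < j)%N ==> (h i < h j)%N].

Definition shuffle n r := {h : {ffun 'I_n -> 'I_r} | increasing h}.

Definition slot n r (h : shuffle n r) (j : 'I_r) : option 'I_n :=
  [pick l | val h l == j].

Definition slot_arity n (a : 'I_n -> nat) (o : option 'I_n) : nat :=
  if o is Some l then a l else 1%N.

Definition slot_val (k : pzRingType) (O : operad k) n (a : 'I_n -> nat)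
    (y : forall l, O (a l)) (o : option 'I_n) : O (slot_arity a o) :=
  match o with Some l => y l | None => op_id O end.

Lemma shuffle_inj n r (h : shuffle n r) : injective (val h).
Proof.
case: h => h /= /forallP incr i j hij; apply: val_inj.
by case: (ltngtP i j) => // lt; [have /forallP/(_ j) := incr i
  |have /forallP/(_ i) := incr j]; rewrite lt hij ltnn.
Qed.

Lemma slot_img n r (h : shuffle n r) l : slot h (val h l) = Some l.
Proof.
rewrite /slot; case: pickP => [l' /eqP/shuffle_inj -> //|/(_ l)].
by rewrite eqxx.
Qed.

Lemma shuffle_arity n r (a : 'I_n -> nat) (h : shuffle n r) N :
  (N + n = r + \sum_(l < n) a l)%N ->
  (\sum_(j < r) slot_arity a (slot h j))%N = N.
Proof.
move=> e; apply/eqP; rewrite -(eqn_add2r n) e {e}.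
have nE : n = (\sum_(j < r) (j \in codom (val h)))%N.
  rewrite -big_mkcond sum1_card /= card_codom ?card_ord //.
  exact: shuffle_inj.
have rE : r = (\sum_(j < r) 1)%N by rewrite sum1_card card_ord.
rewrite [X in (_ + X)%N == _]nE [X in _ == (X + _)%N]rE.
have -> : (\sum_(l < n) a l = \sum_(j < r) if j \in codom (val h) then
   slot_arity a (slot h j) else 0)%N.
  rewrite -big_mkcond /=.
  rewrite [RHS](eq_bigl (mem [set val h l | l : 'I_n])); last first.
    by move=> j; apply/codomP/imsetP => [[l ->]|[l _ ->]]; exists l.
  rewrite big_imset /=; last by move=> ? ? _ _ /shuffle_inj.
  by apply: eq_bigr => l _; rewrite slot_img.
rewrite -!big_split /=; apply/eqP/eq_bigr => j _.
case: ifPn => jh; first by rewrite addnC.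
rewrite addn0 /slot; case: pickP => // l /eqP hl.
by rewrite -hl codom_f in jh.
Qed.

(* Koszul sign of the rearrangement of a finite family of homogeneous symbols *)
(* of degrees deg, from the order given by the positions p to that given by q.*)
Definition koszul_sign (k : unitRingType) (T : finType) (deg : T -> int)
    (p q : T -> nat) : k :=
  \prod_(s : T * T | (p s.1 < p s.2)%N && (q s.2 < q s.1)%N)
     (-1) ^ (deg s.1 * deg s.2).

(* The symbol at the input j is s x_l (degree a l - 1) if j = h l, and s      *)
(* (degree -1) otherwise; in the initial order (s x_n, ..., s x_1, s, ..., s) *)
(* the symbol s x_l comes at the position n - l, and all the s's come after.  *)
Definition slot_degree n (a : 'I_n -> nat) (o : option 'I_n) : int :=
  if o is Some l then (a l)%:Z - 1 else -1.

Definition initial_position n r (h : shuffle n r) (j : 'I_r) : nat :=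
  if slot h j is Some l then rev_ord l : nat else (n + j)%N.

Definition kappa (k : unitRingType) n r (a : 'I_n -> nat) (h : shuffle n r) :
  k := koszul_sign k (fun j => slot_degree a (slot h j)) (initial_position h)
         (fun j : 'I_r => j : nat).

(* An element of arity r of O has degree r - 1 in O[1]; suspensions are left  *)
(* implicit.  The brace x{y_1, ..., y_n} has degree                           *)
(* N - 1 = (r - 1) + \sum_l (a l - 1), which is how its arity N is specified. *)
(* If there is no such N >= 0 then it lives in a zero component (and n > r).  *)
Definition brace (k : fieldType) (O : operad k) r n (a : 'I_n -> nat) N
    (e : (N + n = r + \sum_(l < n) a l)%N) (x : O r) (y : forall l, O (a l)) :
    O N :=
  \sum_(h : shuffle n r)
    kappa k a h *: cast_arity (shuffle_arity h e)
                     (op_comp x (fun j => slot_val y (slot h j))).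

Lemma circ_arity m n N : (N + 1 = m + n)%N ->
  (N + 1 = m + \sum_(l < 1) n)%N.
Proof. by rewrite big_ord1. Qed.

Definition circ (k : fieldType) (O : operad k) m n N (e : (N + 1 = m + n)%N)
    (x : O m) (y : O n) : O N :=
  brace (circ_arity e) x (fun=> y).

Record operad_with_mul (k : fieldType) := OperadWithMul {
  om_operad :> operad k;
  om_mul : om_operad 2;
  om_mulP : circ (erefl : (3 + 1 = 2 + 2)%N) om_mul om_mul = 0
}.

(* The operations of an hG-algebra V = \bigoplus_n V n, on homogeneous        *)
(* elements; the braces are those of V[1], with the above conventions.        *)
Record hG_structure (k : fieldType) := HGStructure {
  hG_space :> nat -> lmodType k;
  hG_brace : forall r n (a : 'I_n -> nat) N,
    (N + n = r + \sum_(l < n) a l)%N ->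
    hG_space r -> (forall l, hG_space (a l)) -> hG_space N;
  hG_dot : forall m n, hG_space m -> hG_space n -> hG_space (m + n)%N;
  hG_diff : forall n, hG_space n -> hG_space n.+1
}.

Section DerivedHG.
Variables (k : fieldType) (O : operad_with_mul k).

Definition pair_arity m n (i : 'I_2) : nat := if i == ord0 then m else n.

Definition pair_val m n (x : O m) (y : O n) (i : 'I_2) :
    O (pair_arity m n i) :=
  if i == ord0 as b return O (if b then m else n) then x else y.

Lemma dot_arity m n : (m + n + 2 = 2 + \sum_(i < 2) pair_arity m n i)%N.
Proof. by rewrite big_ord_recl big_ord1 addnC. Qed.

Definition op_dot m n (x : O m) (y : O n) : O (m + n)%N :=
  (-1) ^+ m *: brace (dot_arity m n) (om_mul O) (pair_val x y).

Lemma diff_arityl n : (n.+1 + 1 = 2 + n)%N.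
Proof. by rewrite addn1. Qed.

Lemma diff_arityr n : (n.+1 + 1 = n + 2)%N.
Proof. by rewrite addn1 addn2. Qed.

Definition op_shifted_diff n (x : O n) : O n.+1 :=
  circ (diff_arityl n) (om_mul O) x
    - (-1) ^ (n%:Z - 1) *: circ (diff_arityr n) x (om_mul O).

Definition op_diff n (x : O n) : O n.+1 := - op_shifted_diff x.

Definition derived_hG : hG_structure k :=
  @HGStructure k (fun n => O n) (@brace k O) op_dot op_diff.

End DerivedHG.

Record hG_isomorphism (k : fieldType) (V W : hG_structure k)
    (phi : forall n, V n -> W n) : Prop := HGIsomorphism {
  hG_iso_linear : forall n, linear (@phi n);
  hG_iso_bij : forall n, bijective (@phi n);
  hG_iso_brace : forall r n (a : 'I_n -> nat) N
      (e : (N + n = r + \sum_(l < n) a l)%N) (x : V r) (y : forall l, V (a l)),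
    phi N (hG_brace e x y) = hG_brace e (phi r x) (fun l => phi (a l) (y l));
  hG_iso_dot : forall m n (x : V m) (y : V n),
    phi (m + n)%N (hG_dot x y) = hG_dot (phi m x) (phi n y);
  hG_iso_diff : forall n (x : V n), phi n.+1 (hG_diff x) = hG_diff (phi n x)
}.

Definition offset r (a : 'I_r -> nat) (p : nat) : nat :=
  (\sum_(l < r | (l < p)%N) a l)%N.

Section Offset.
Variables (r : nat) (a : 'I_r -> nat).

Lemma offset0 : offset a 0 = 0%N.
Proof. by rewrite /offset big_pred0. Qed.

Lemma offset_full : offset a r = (\sum_(i < r) a i)%N.
Proof. by apply: eq_bigl => i; rewrite ltn_ord. Qed.

Lemma offsetS (i : 'I_r) : offset a i.+1 = (offset a i + a i)%N.
Proof.
rewrite /offset (bigD1 i) ?ltnS //= addnC; congr addn.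
by apply: eq_bigl => l; rewrite ltnS [RHS]ltn_neqAle andbC.
Qed.

Lemma leq_offset p q : (p <= q)%N -> (offset a p <= offset a q)%N.
Proof.
move=> pq; rewrite /offset [leqRHS](bigID (fun l : 'I_r => (l < p)%N)) /=.
rewrite [X in (_ <= X + _)%N](eq_bigl (fun l : 'I_r => (l < p)%N)) ?leq_addr //.
by move=> l; case: (ltnP l p) => lp; rewrite ?andbF // andbT (leq_trans lp pq).
Qed.

Lemma offset_le p : (offset a p <= \sum_(i < r) a i)%N.
Proof.
rewrite -offset_full; case: (leqP p r) => [/leq_offset //|rp].
rewrite /offset; apply: eq_leq; apply: eq_bigl => l.
by rewrite ltn_ord (ltn_trans _ rp).
Qed.

Lemma RankE (i : 'I_r) (j : 'I_(a i)) :
  tagnat.Rank i j = (offset a i + j)%N :> nat.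
Proof. exact: tagnat.RankEsum. Qed.

Lemma RankP (t : 'I_(\sum_(i < r) a i)) : {i & {j | t = tagnat.Rank i j}}.
Proof. by exists (tagnat.sig1 t), (tagnat.sig2 t); rewrite tagnat.sig2K. Qed.

Lemma Rank_inj (i : 'I_r) : injective (tagnat.Rank (p_ := a) i).
Proof.
by move=> j j' /(congr1 val)/eqP; rewrite tagnat.eq_Rank eqxx => /eqP/val_inj.
Qed.

Lemma big_Rank R (idx : R) (op : Monoid.com_law idx)
    (Q : pred 'I_(\sum_(i < r) a i)) (F : 'I_(\sum_(i < r) a i) -> R) :
  \big[op/idx]_(t | Q t) F t =
  \big[op/idx]_(i < r) \big[op/idx]_(j < a i | Q (tagnat.Rank i j))
     F (tagnat.Rank i j).
Proof.
rewrite sig_big_dep /= (reindex tagnat.rank) /=; last first.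
  exact/onW_bij/tagnat.rank_bij.
by apply: eq_big => -[i j].
Qed.

Lemma offset_offset (b : 'I_(\sum_(i < r) a i) -> nat) (i : 'I_r) j :
    (j <= a i)%N ->
  offset b (offset a i + j) =
  (offset (fun i => \sum_(j < a i) b (tagnat.Rank i j))%N i
   + offset (fun j => b (tagnat.Rank i j)) j)%N.
Proof.
move=> ja; rewrite {1}/offset big_Rank (bigD1 i) // [LHS]addnC; congr addn.
  rewrite /offset [LHS]big_mkcond [RHS]big_mkcond; apply: eq_bigr => l _.
  case: (ltngtP l i) => [lt|gt|/val_inj ->]; last by rewrite eqxx.
  - have -> : l != i by rewrite -val_eqE neq_ltn lt.
    apply: eq_bigl => q; rewrite RankE; apply: leq_trans (leq_addr _ _).
    by apply: leq_trans (leq_offset lt); rewrite offsetS -addnS leq_add2l.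
  have -> : l != i by rewrite -val_eqE neq_ltn gt orbT.
  apply: big_pred0 => q; apply/negbTE; rewrite RankE -leqNgt.
  apply: leq_trans (leq_addr _ _); apply: leq_trans (leq_offset gt).
  by rewrite offsetS leq_add2l.
by apply: eq_bigl => q; rewrite RankE ltn_add2l.
Qed.

End Offset.

Section RelativeHochschild.
Variables (k : fieldType) (A : algebra k) (S : set A).

Local Notation "x ** y" := (@alg_mul k A x y) (at level 40, left associativity).

Definition multilinear n (f : ('I_n -> A) -> A) : Prop :=
  forall (v : 'I_n -> A) (i : 'I_n), linear (fun x : A => f [eta v with i |-> x]).

(* C^n(A, S; A); for n = 0, f is identified with its unique value.            *)
Record relative n (f : ('I_n -> A) -> A) : Prop := Relative {
  rel_multilinear : multilinear f;
  rel_left : forall b, S b -> forall v (i : 'I_n), i = 0%N :> nat ->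
    f [eta v with i |-> b ** v i] = b ** f v;
  rel_mid : forall b, S b -> forall v (i j : 'I_n), j = i.+1 :> nat ->
    f [eta v with i |-> v i ** b] = f [eta v with j |-> b ** v j];
  rel_right : forall b, S b -> forall v (i : 'I_n), i.+1 = n ->
    f [eta v with i |-> v i ** b] = f v ** b;
  rel_zero : n = 0%N -> forall b, S b -> forall v, f v ** b = b ** f v
}.

Lemma alg_mulD x y z c : x ** (c *: y + z) = c *: (x ** y) + x ** z.
Proof. exact: (alg_mul_linearr x). Qed.

Lemma alg_mulDr x y z c : (c *: y + z) ** x = c *: (y ** x) + z ** x.
Proof. exact: (alg_mul_linearl x). Qed.

Lemma alg_mul0 x : x ** 0 = 0 /\ 0 ** x = 0.
Proof.
have := alg_mulD x 0 0 (-1); have := alg_mulDr x 0 0 (-1).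
by rewrite scaler0 addr0 !scaleN1r !addNr.
Qed.

Definition relative_pred n : {pred ('I_n -> A) -> A} :=
  fun f => `[< relative f >].

Lemma relative_submod n : submod_closed (@relative_pred n).
Proof.
split.
  apply/asboolP; split.
  - by move=> v i c x y /=; rewrite scaler0 addr0.
  - by move=> b _ v i _; rewrite (alg_mul0 b).1.
  - by [].
  - by move=> b _ v i _; rewrite (alg_mul0 b).2.
  - by move=> _ b _ v; rewrite (alg_mul0 b).1 (alg_mul0 b).2.
move=> c f g /asboolP[f1 f2 f3 f4 f5] /asboolP[g1 g2 g3 g4 g5].
apply/asboolP; split.
- move=> v i d x y; rewrite -!['I_n -> A]/('I_n -> A) /=.
  have := f1 v i d x y; have := g1 v i d x y; rewrite /= => gE fE.
  rewrite -[LHS]/(c *: f _ + g _) fE gE.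
  rewrite -[in RHS]/(c *: f _ + g _) !scalerDr !scalerA (mulrC c d).
  by rewrite -!addrA; congr (_ + _); rewrite addrCA.
- move=> b Sb v i i0; rewrite -[LHS]/(c *: f _ + g _) f2 // g2 //.
  by rewrite -alg_mulD.
- move=> b Sb v i j ij; rewrite -[LHS]/(c *: f _ + g _).
  by rewrite (f3 _ Sb _ _ _ ij) (g3 _ Sb _ _ _ ij).
- move=> b Sb v i i0; rewrite -[LHS]/(c *: f _ + g _) f4 // g4 //.
  by rewrite -alg_mulDr.
- move=> n0 b Sb v; rewrite -[LHS]/((c *: f v + g v) ** b).
  by rewrite -[RHS]/(b ** (c *: f v + g v)) alg_mulD alg_mulDr f5 ?g5.
Qed.

Record hochschild n := Hochschild {
  hoch_fun :> ('I_n -> A) -> A;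
  _ : hoch_fun \in @relative_pred n
}.

HB.instance Definition _ n := [isSub for @hoch_fun n].
HB.instance Definition _ n := [Choice of hochschild n by <:].
HB.instance Definition _ n := GRing.SubChoice_isSubLmodule.Build
  k (('I_n -> A) -> A) (@relative_pred n) (hochschild n) (@relative_submod n).

Lemma hochschildP n (f : hochschild n) : relative f.
Proof. by case: f => f /= /asboolP. Qed.

Lemma hochschild_eq n (f g : hochschild n) : (forall v, f v = g v) -> f = g.
Proof. by move=> fg; apply: val_inj; apply: funext. Qed.

Definition hoch_id_fun (v : 'I_1 -> A) : A := v ord0.

Lemma hoch_id_subproof : hoch_id_fun \in @relative_pred 1.
Proof.
apply/asboolP; split=> //.
- by move=> v i c x y; rewrite /hoch_id_fun /= (ord1 i) eqxx.
- by move=> b _ v i _; rewrite /hoch_id_fun /= (ord1 i) eqxx.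
- by move=> b _ v i j; rewrite (ord1 i) (ord1 j).
- by move=> b _ v i _; rewrite /hoch_id_fun /= (ord1 i) eqxx.
Qed.

Definition hoch_id : hochschild 1 := Hochschild hoch_id_subproof.

Section Comp.
Variables (r : nat) (a : 'I_r -> nat).
Variables (f : hochschild r) (g : forall i, hochschild (a i)).

Definition hoch_args (v : 'I_(\sum_(i < r) a i) -> A) (i : 'I_r) : A :=
  g i (fun j => v (tagnat.Rank i j)).

Definition hoch_comp_fun (v : 'I_(\sum_(i < r) a i) -> A) : A :=
  f (hoch_args v).

Lemma hoch_comp_with v i (j : 'I_(a i)) x :
  hoch_comp_fun [eta v with tagnat.Rank i j |-> x] =
  f [eta hoch_args v with i |->
       g i [eta (fun j => v (tagnat.Rank i j)) with j |-> x]].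
Proof.
congr (hoch_fun f _); apply: funext => i'; rewrite /hoch_args /=.
case: eqVneq => [->|ne]; congr (hoch_fun (g _) _); apply: funext => j' /=.
  by rewrite (inj_eq (@Rank_inj _ _ _)).
by case: eqP => // /(congr1 val)/eqP; rewrite tagnat.eq_Rank (negbTE ne).
Qed.

(* The value obtained by letting b act between the p-th and p+1-st arguments. *)
Let slide b v (p : nat) : A :=
  if p is p'.+1 then
    if insub p' is Some i then
      f [eta hoch_args v with i |-> hoch_args v i ** b] else 0
  else b ** f (hoch_args v).

Let slideS b v (i : 'I_r) :
  slide b v i.+1 = f [eta hoch_args v with i |-> hoch_args v i ** b].
Proof. by rewrite /slide valK. Qed.

Let slide_left b v (i : 'I_r) : S b ->
  slide b v i = f [eta hoch_args v with i |-> b ** hoch_args v i].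
Proof.
move=> Sb; have [fm fl fmid fr fz] := hochschildP f.
case: (posnP i) => [i0|i0]; first by rewrite i0 /= fl.
have lt : (i.-1 < r)%N by apply: leq_ltn_trans (ltn_ord i); rewrite leq_pred.
have -> : i = (Ordinal lt).+1 :> nat by rewrite /= prednK.
by rewrite slideS; apply: (fmid b Sb); rewrite /= prednK.
Qed.

Let slide_right b v : S b -> slide b v r = f (hoch_args v) ** b.
Proof.
move=> Sb; have [fm fl fmid fr fz] := hochschildP f.
case: (posnP r) => [r0|r0].
  have -> : slide b v r = slide b v 0 by congr (slide b v _).
  by rewrite /= fz.
have lt : (r.-1 < r)%N by rewrite ltn_predL.
have -> : slide b v r = slide b v (Ordinal lt).+1.
  by congr (slide b v _); rewrite /= prednK.
rewrite slideS.
by apply: (fr b Sb); rewrite /= prednK.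
Qed.

Let slide0 b v (i : 'I_r) : S b -> a i = 0%N -> slide b v i.+1 = slide b v i.
Proof.
move=> Sb ai; rewrite slideS slide_left // {2}/hoch_args.
by rewrite (rel_zero (hochschildP (g i)) ai Sb).
Qed.

Let slide_eq b v p q : S b -> (p <= q)%N -> (q <= r)%N ->
  offset a p = offset a q -> slide b v p = slide b v q.
Proof.
move=> Sb; elim: q => [|q IH]; first by rewrite leqn0 => /eqP ->.
rewrite leq_eqVlt => /orP[/eqP -> //|]; rewrite ltnS => pq qr e.
have qE := offsetS a (Ordinal qr); have pqa := leq_offset a pq.
have [a0 eq] : a (Ordinal qr) = 0%N /\ offset a p = offset a q.
  move: qE; rewrite /= -e => qE.
  by split; apply/eqP; [rewrite -leqn0 -(leq_add2l (offset a q)) -qE addn0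
     |rewrite eqn_leq pqa qE leq_addr].
by rewrite (IH pq (ltnW qr) eq) -[q]/(nat_of_ord (Ordinal qr)) slide0.
Qed.

Lemma hoch_comp_subproof : hoch_comp_fun \in @relative_pred _.
Proof.
have [fm fl fmid fr fz] := hochschildP f.
apply/asboolP; split.
- move=> v t c x y /=; have [i [j ->]] := RankP t; rewrite !hoch_comp_with.
  by rewrite (rel_multilinear (hochschildP (g i))) fm.
- move=> b Sb v t; have [i [j ->]] := RankP t; rewrite RankE hoch_comp_with.
  move=> /eqP; rewrite addn_eq0 => /andP[/eqP i0 /eqP j0].
  rewrite (rel_left (hochschildP (g i))) // -/(hoch_args v i) -slide_left //.
  by rewrite -[RHS]/(slide b v 0); apply/esym/slide_eq; rewrite ?offset0 ?(ltnW (ltn_ord i)).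
- move=> b Sb v t t'.
  have [i [j ->]] := RankP t; have [i' [j' ->]] := RankP t'.
  rewrite !RankE !hoch_comp_with => e.
  have lj := ltn_ord j; have lj' := ltn_ord j'.
  case: (ltngtP i i') => [lt|gt|/val_inj ii]; last first.
  + rewrite -{i'}ii in j' lj' e *.
    rewrite (rel_mid (hochschildP (g i)) Sb _ (_ : j' = j.+1 :> nat)) //.
    by apply/eqP; rewrite -(eqn_add2l (offset a i)) e addnS.
  + have le := leq_offset a gt; rewrite offsetS in le.
    have := ltn_add2l (offset a i') j' (a i'); rewrite lj' e => lt2.
    have := leq_trans lt2 le.
    by rewrite -!addnS -[leqRHS]addn0 leq_add2l.
  have le := leq_offset a lt; rewrite offsetS in le.
  have jE : j.+1 = a i.
    apply/eqP; rewrite eqn_leq lj /= -(leq_add2l (offset a i)) (leq_trans le) //.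
    by rewrite addnS -e leq_addr.
  have oE : offset a i.+1 = offset a i'.
    by apply/eqP; rewrite eqn_leq leq_offset // offsetS -jE addnS -e leq_addr.
  have j0 : j' = 0%N :> nat.
    apply/eqP; rewrite -(eqn_add2l (offset a i')) e addn0 -oE offsetS.
    by rewrite -addnS jE.
  rewrite (rel_right (hochschildP (g i))) // (rel_left (hochschildP (g i'))) //.
  rewrite -/(hoch_args v i) -/(hoch_args v i') -slideS -slide_left //.
  by apply: slide_eq => //; rewrite ltnW.
- move=> b Sb v t; have [i [j ->]] := RankP t; rewrite RankE hoch_comp_with.
  rewrite -addnS -offset_full => e.
  have jE : j.+1 = a i.
    apply/eqP; rewrite eqn_leq ltn_ord /= -(leq_add2l (offset a i)) e -offsetS.
    exact: leq_offset.
  rewrite (rel_right (hochschildP (g i))) // -/(hoch_args v i) -slideS.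
  by rewrite -slide_right //; apply: slide_eq; rewrite // offsetS -jE.
- move=> N0 b Sb v; rewrite -slide_right // -[RHS]/(slide b v 0).
  by apply/esym/slide_eq; rewrite // offset0 offset_full.
Qed.

Definition hoch_comp : hochschild (\sum_(i < r) a i)%N :=
  Hochschild hoch_comp_subproof.

End Comp.

Lemma hoch_same m n (e : m = n) (f : hochschild m) (g : hochschild n) :
  (forall v, f (fun i => v (cast_ord e i)) = g v) ->
  @same_arity_eq k (fun n => hochschild n) m n f g.
Proof.
move=> fg; exists e; case: n / e g fg => g fg.
apply: hochschild_eq => v; rewrite -fg /cast_arity /=.
by congr (hoch_fun f _); apply: funext => i; rewrite cast_ord_id.
Qed.

Lemma hoch_comp_linearl r (a : 'I_r -> nat) (g : forall i, hochschild (a i)) :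
  linear (fun f : hochschild r => hoch_comp f g).
Proof. by move=> c f f'; apply: hochschild_eq. Qed.

Lemma hoch_comp_linearr r (a : 'I_r -> nat) (f : hochschild r)
    (g : forall i, hochschild (a i)) (i : 'I_r) :
  linear (fun h : hochschild (a i) => hoch_comp f (dfwith g h)).
Proof.
have argsE h v : hoch_args (dfwith g h) v =
    [eta hoch_args g v with i |-> h (fun j => v (tagnat.Rank i j))].
  apply: funext => i'; rewrite /hoch_args /=; case: eqVneq => [->|ne].
    by rewrite dfwith_in.
  by rewrite dfwith_out // eq_sym.
move=> c h h'; apply: hochschild_eq => v /=.
by rewrite /hoch_comp_fun argsE (rel_multilinear (hochschildP f)) /= -!argsE.
Qed.

Lemma hoch_comp1l n (f : hochschild n) :
  @same_arity_eq k (fun n => hochschild n) _ _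
    (hoch_comp (a := fun _ : 'I_1 => n) hoch_id (fun=> f)) f.
Proof.
have e : (\sum_(i < 1) n = n)%N by rewrite big_ord1.
apply: (hoch_same (e := e)) => v; rewrite /= /hoch_comp_fun /= /hoch_id_fun.
congr (hoch_fun f _); apply: funext => j; congr v; apply: val_inj.
by rewrite [LHS](RankE (a := fun _ : 'I_1 => n)) /= offset0.
Qed.

Lemma offset_ones n p : (p <= n)%N -> offset (fun _ : 'I_n => 1%N) p = p.
Proof.
move=> pn; rewrite /offset -(big_ord_widen n (fun=> 1%N) pn).
by rewrite sum1_card card_ord.
Qed.

Lemma hoch_comp1r n (f : hochschild n) :
  @same_arity_eq k (fun n => hochschild n) _ _
    (hoch_comp (a := fun _ : 'I_n => 1%N) f (fun=> hoch_id)) f.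
Proof.
have e : (\sum_(i < n) 1 = n)%N by rewrite sum1_card card_ord.
apply: (hoch_same (e := e)) => v; rewrite /= /hoch_comp_fun.
congr (hoch_fun f _); apply: funext => j; congr v; apply: val_inj.
rewrite [LHS](RankE (a := fun _ : 'I_n => 1%N)) offset_ones ?addn0 //.
by rewrite ltnW.
Qed.

Lemma hoch_compA r (a : 'I_r -> nat) (b : 'I_(\sum_(i < r) a i) -> nat)
    (x : hochschild r) (y : forall i, hochschild (a i))
    (z : forall t, hochschild (b t)) :
  @same_arity_eq k (fun n => hochschild n) _ _
    (hoch_comp (hoch_comp x y) z)
    (hoch_comp x
      (fun i => hoch_comp (y i) (fun j => z (tagnat.Rank i j)))).
Proof.
have e : (\sum_t b t = \sum_(i < r) \sum_(j < a i) b (tagnat.Rank i j))%N.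
  exact: big_Rank.
apply: (hoch_same (e := e)) => v /=; rewrite /hoch_comp_fun /=.
rewrite /hoch_comp_fun; congr (hoch_fun x _); apply: funext => i.
rewrite /hoch_args /= /hoch_comp_fun; congr (hoch_fun (y i) _).
apply: funext => j; rewrite /hoch_args; congr (hoch_fun (z _) _).
apply: funext => l; congr v; apply: val_inj.
rewrite [LHS](RankE (a := b)) RankE offset_offset; last by rewrite ltnW.
by rewrite [RHS]RankE RankE addnA.
Qed.

Definition hochschild_operad : operad k :=
  Operad hoch_comp_linearl hoch_comp_linearr hoch_comp1l hoch_comp1r hoch_compA.

Definition hoch_mul_fun (v : 'I_2 -> A) : A := v ord0 ** v ord_max.

Lemma hoch_mul_subproof : hoch_mul_fun \in @relative_pred 2.
Proof.
apply/asboolP; split=> //.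
- move=> v i c x y; rewrite /hoch_mul_fun /=.
  have [->|->] : i = ord0 \/ i = ord_max.
  + by case: i => -[|[|]] //= p; [left|right]; apply: val_inj.
  + by rewrite /= alg_mulDr.
  + by rewrite /= alg_mulD.
- move=> b _ v i i0; have -> : i = ord0 by apply: val_inj.
  by rewrite /hoch_mul_fun /= alg_mulA.
- move=> b _ v i j; case: j => -[|[|]] //= p [i0].
  have -> : i = ord0 by apply: val_inj; rewrite /= -i0.
  have -> : Ordinal p = ord_max by apply: val_inj.
  by rewrite /hoch_mul_fun /= alg_mulA.
- move=> b _ v i [i0]; have -> : i = ord_max by apply: val_inj.
  by rewrite /hoch_mul_fun /= alg_mulA.
Qed.

Definition hoch_mul : hochschild 2 := Hochschild hoch_mul_subproof.

End RelativeHochschild.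

Lemma circ_shuffle_subproof r (i : 'I_r) :
  increasing ([ffun=> i] : {ffun 'I_1 -> 'I_r}).
Proof. by apply/'forall_forallP => j l; rewrite (ord1 j) (ord1 l). Qed.

Definition circ_shuffle r (i : 'I_r) : shuffle 1 r :=
  exist (fun h => increasing h) _ (circ_shuffle_subproof i).

Lemma circ_shuffle_bij r : bijective (@circ_shuffle r).
Proof.
exists (fun h : shuffle 1 r => val h ord0) => [i|h]; first by rewrite ffunE.
by apply/val_inj/ffunP => j; rewrite ffunE (ord1 j).
Qed.

Lemma slot_circ r (i j : 'I_r) :
  slot (circ_shuffle i) j = if i == j then Some ord0 else None.
Proof.
rewrite /slot; case: pickP => [l|/(_ ord0)]; rewrite ffunE.
  by move=> ->; rewrite (ord1 l).
by move=> ->.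
Qed.

Lemma circ_mul_eq0 (k : fieldType) (O : operad k) (m : O 2)
    (e : (3 + 1 = 2 + 2)%N) :
  let t i := cast_arity (shuffle_arity (circ_shuffle i) (circ_arity e))
    (op_comp m (fun j => slot_val (fun=> m) (slot (circ_shuffle i) j))) in
  t ord0 = t ord_max -> circ e m m = 0.
Proof.
move=> t tE; rewrite /circ /brace (reindex (@circ_shuffle 2)) /=; last first.
  exact/onW_bij/circ_shuffle_bij.
rewrite big_ord_recl big_ord1 -/(t _) -/(t _).
have -> : lift ord0 ord0 = ord_max :> 'I_2 by apply: val_inj.
rewrite -tE -scalerDl; apply/eqP; rewrite scaler_eq0; apply/orP; left.
rewrite /kappa /koszul_sign big_pred0 => [|[s1 s2]]; last first.
  rewrite /initial_position !slot_circ /=.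
  by case: s1 => -[|[|]] // ? ; case: s2 => -[|[|]] // ?.
rewrite (big_pred1 (ord_max, ord0)) => [|[s1 s2]]; last first.
  rewrite /initial_position !slot_circ /=.
  by case: s1 => -[|[|]] // ? ; case: s2 => -[|[|]] // ?.
by rewrite !slot_circ /= mulrN1 /= exprN1 invrN1 subrr.
Qed.

Lemma hoch_mulP (k : fieldType) (A : algebra k) (S : set A) :
  circ (O := hochschild_operad S) (erefl : (3 + 1 = 2 + 2)%N)
    (hoch_mul S) (hoch_mul S) = 0.
Proof.
apply: circ_mul_eq0; apply: hochschild_eq => v.
have castE m n (e : m = n) (x : hochschild S m) w :
    (@cast_arity k (fun n => hochschild S n) _ _ e x : hochschild S n) w =
    x (fun i => w (cast_ord e i)).
  case: n / e w => w; congr (hoch_fun x _); apply: funext => i.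
  by rewrite cast_ord_id.
have valE a (y : forall l : 'I_1, hochschild_operad S (a l)) o l
    (e : o = Some l) w :
    (slot_val y o : hochschild S _) w =
    (y l : hochschild S _)
      (fun j => w (cast_ord (congr1 (slot_arity a) (esym e)) j)).
  subst o; congr (hoch_fun (y l) _).
  by apply: funext => j; rewrite cast_ord_id.
have valN a (y : forall l : 'I_1, hochschild_operad S (a l)) o
    (e : o = None) w :
    (slot_val y o : hochschild S _) w =
      w (cast_ord (congr1 (slot_arity a) (esym e)) ord0).
  by subst o; rewrite cast_ord_id.
pose h i : shuffle 1 2 := circ_shuffle i.
have h00 : slot (h ord0) ord0 = Some ord0 by rewrite slot_circ.
have h01 : slot (h ord0) ord_max = None by rewrite slot_circ.
have h10 : slot (h ord_max) ord0 = None by rewrite slot_circ.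
have h11 : slot (h ord_max) ord_max = Some ord0 by rewrite slot_circ.
have oE (a : 'I_2 -> nat) : offset a 1 = a ord0.
  by rewrite (offsetS a ord0) offset0.
rewrite !castE /= /hoch_comp_fun /= /hoch_mul_fun /hoch_args.
rewrite (valE _ _ _ _ h00) (valN _ _ _ h01) (valN _ _ _ h10).
rewrite (valE _ _ _ _ h11) /= /hoch_mul_fun.
rewrite -alg_mulA.
by congr alg_mul; [|congr alg_mul]; congr v; apply: val_inj;
  rewrite [LHS]RankE [RHS]RankE /= ?offset0 ?oE ?h00 ?h10.
Qed.

Definition hochschild_operad_with_mul (k : fieldType) (A : algebra k)
  (S : set A) : operad_with_mul k := OperadWithMul (hoch_mulP S).

Section SimplicialCochains.
Variables (k : fieldType) (d : Order.disp_t) (P : porderType d).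

(* n-simplices v_0 <= ... <= v_n of the nerve, degenerate ones included.      *)
Record simplex n := Simplex {
  vertex :> 'I_n.+1 -> P;
  simplex_mono : forall i j : 'I_n.+1, (i <= j)%N -> (vertex i <= vertex j)%O
}.

Lemma simplex_eq n (v w : simplex n) : (forall i, v i = w i) -> v = w.
Proof.
case: v w => [v vP] [w wP] /= /funext vw.
by case: w / vw in wP *; congr Simplex; apply: Prop_irrelevance.
Qed.

Definition face n m (v : simplex n) (h : 'I_m.+1 -> 'I_n.+1)
    (hP : forall i j : 'I_m.+1, (i <= j)%N -> (h i <= h j)%N) : simplex m :=
  @Simplex m (fun i => v (h i)) (fun i j ij => simplex_mono v (hP i j ij)).

Definition cochain n := simplex n -> k^o.

Section Comp.
Variables (r : nat) (a : 'I_r -> nat).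

Definition outer_index (i : 'I_r.+1) : 'I_(\sum_(i < r) a i)%N.+1 :=
  @Ordinal (\sum_(i < r) a i)%N.+1 (offset a i) (offset_le a i).

Lemma outer_mono (i j : 'I_r.+1) :
  (i <= j)%N -> (outer_index i <= outer_index j)%N.
Proof. exact: leq_offset. Qed.

Lemma inner_le (i : 'I_r) (j : 'I_(a i).+1) :
  (offset a i + j <= \sum_(i < r) a i)%N.
Proof.
apply: leq_trans (offset_le a i.+1).
by rewrite offsetS leq_add2l -ltnS ltn_ord.
Qed.

Definition inner_index (i : 'I_r) (j : 'I_(a i).+1) :
    'I_(\sum_(i < r) a i)%N.+1 :=
  @Ordinal (\sum_(i < r) a i)%N.+1 (offset a i + j) (inner_le j).

Lemma inner_mono (i : 'I_r) (j l : 'I_(a i).+1) :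
  (j <= l)%N -> (inner_index j <= inner_index l)%N.
Proof. by rewrite /= leq_add2l. Qed.

Definition outer_face (v : simplex (\sum_(i < r) a i)) : simplex r :=
  face v outer_mono.

Definition inner_face (v : simplex (\sum_(i < r) a i)) (i : 'I_r) :
  simplex (a i) := face v (@inner_mono i).

Definition coch_comp (f : cochain r) (g : forall i, cochain (a i)) :
    cochain (\sum_(i < r) a i) :=
  fun v => (f (outer_face v) : k) * \prod_(i < r) (g i (inner_face v i) : k).

End Comp.

Definition coch_id : cochain 1 := fun=> 1.

Definition coch_mul : cochain 2 := fun=> 1.

Lemma coch_cast m n (e : m = n) (f : cochain m) (v : simplex n) (w : simplex m) :
  (forall i, w i = v (cast_ord (congr1 S e) i)) ->
  (@cast_arity k (fun n => cochain n) _ _ e f : cochain n) v = f w.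
Proof.
case: n / e v => v wE; congr f; apply: simplex_eq => i.
by rewrite wE cast_ord_id.
Qed.

Lemma coch_same m n (e : m = n) (f : cochain m) (g : cochain n) :
  (forall (v : simplex n) (w : simplex m),
     (forall i, w i = v (cast_ord (congr1 S e) i)) -> f w = g v) ->
  @same_arity_eq k (fun n => cochain n) m n f g.
Proof.
move=> fg; exists e; apply: funext => v.
have hP (i j : 'I_m.+1) : (i <= j)%N ->
  (cast_ord (congr1 S e) i <= cast_ord (congr1 S e) j)%N by [].
rewrite (@coch_cast _ _ e f v (face v hP)) //.
exact: fg.
Qed.

Lemma coch_comp_linearl r (a : 'I_r -> nat) (g : forall i, cochain (a i)) :
  linear (fun f : cochain r => coch_comp f g).
Proof.
move=> c f f'; apply: funext => v.
rewrite /coch_comp -[RHS]/(c * (f _ * _) + f' _ * _).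
by rewrite -[LHS]/((c * f _ + f' _) * _) mulrDl mulrA.
Qed.

Lemma coch_comp_linearr r (a : 'I_r -> nat) (f : cochain r)
    (g : forall i, cochain (a i)) (i : 'I_r) :
  linear (fun h : cochain (a i) => coch_comp f (dfwith g h)).
Proof.
have prodE (h : cochain (a i)) v :
    \prod_(j < r) (dfwith g h j (inner_face v j) : k) =
    (h (inner_face v i) : k) *
      \prod_(j < r | j != i) (g j (inner_face v j) : k).
  rewrite (bigD1 i) //= dfwith_in; congr (_ * _); apply: eq_bigr => j ji.
  by rewrite dfwith_out // eq_sym.
move=> c h h'; apply: funext => v; rewrite /coch_comp prodE.
rewrite -[RHS]/(c * (_ * _) + _ * _) !prodE.
rewrite -[X in _ * (X * _)]/(c * (h _ : k) + h' _).
by rewrite mulrDl mulrDr -[in LHS]mulrA mulrCA.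
Qed.

Lemma coch_comp1l n (f : cochain n) :
  @same_arity_eq k (fun n => cochain n) _ _
    (coch_comp (a := fun _ : 'I_1 => n) coch_id (fun=> f)) f.
Proof.
have e : (\sum_(i < 1) n = n)%N by rewrite big_ord1.
apply: (coch_same (e := e)) => v w wE.
rewrite /coch_comp mul1r big_ord1; congr f; apply: simplex_eq => i /=.
by rewrite wE; congr (vertex v); apply: val_inj; rewrite /= offset0.
Qed.

Lemma coch_comp1r n (f : cochain n) :
  @same_arity_eq k (fun n => cochain n) _ _
    (coch_comp (a := fun _ : 'I_n => 1%N) f (fun=> coch_id)) f.
Proof.
have e : (\sum_(i < n) 1 = n)%N by rewrite sum1_card card_ord.
apply: (coch_same (e := e)) => v w wE.
rewrite /coch_comp big1 // mulr1; congr f; apply: simplex_eq => i /=.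
rewrite wE; congr (vertex v); apply: val_inj => /=.
by rewrite offset_ones // -ltnS ltn_ord.
Qed.

Lemma offset_offset_full r (a : 'I_r -> nat)
    (b : 'I_(\sum_(i < r) a i) -> nat) p : (p <= r)%N ->
  offset b (offset a p) =
  offset (fun i => \sum_(j < a i) b (tagnat.Rank i j))%N p.
Proof.
rewrite leq_eqVlt => /orP[/eqP ->|lt].
  rewrite !offset_full.
  have := offset_full b; rewrite -[X in offset b X]/(_) => <-.
  by rewrite offset_full big_Rank.
have := offset_offset b (leq0n (a (Ordinal lt))).
by rewrite offset0 !addn0.
Qed.

Lemma coch_compA r (a : 'I_r -> nat) (b : 'I_(\sum_(i < r) a i) -> nat)
    (x : cochain r) (y : forall i, cochain (a i))
    (z : forall t, cochain (b t)) :
  @same_arity_eq k (fun n => cochain n) _ _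
    (coch_comp (coch_comp x y) z)
    (coch_comp x (fun i => coch_comp (y i) (fun j => z (tagnat.Rank i j)))).
Proof.
have e : (\sum_t b t = \sum_(i < r) \sum_(j < a i) b (tagnat.Rank i j))%N.
  exact: big_Rank.
apply: (coch_same (e := e)) => v w wE.
rewrite /coch_comp big_split /= mulrA; congr (_ * _ * _).
- congr x; apply: simplex_eq => i /=; rewrite wE; congr (vertex v).
  by apply: val_inj; rewrite /= offset_offset_full // -ltnS.
- apply: eq_bigr => i _; congr (y i _); apply: simplex_eq => j /=.
  rewrite wE; congr (vertex v); apply: val_inj.
  by rewrite /= offset_offset // -ltnS.
rewrite big_Rank; apply: eq_bigr => i _; apply: eq_bigr => j _.
congr (z _ _); apply: simplex_eq => l; rewrite /= wE; congr (vertex v).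
apply: val_inj; rewrite -[LHS]/(offset b (tagnat.Rank i j) + l)%N RankE.
rewrite offset_offset; last exact: ltnW.
by rewrite -[RHS]/(offset _ i + (offset _ j + l))%N addnA.
Qed.

Definition simplicial_operad : operad k :=
  @Operad k (fun n => cochain n) coch_id coch_comp coch_comp_linearl coch_comp_linearr
    coch_comp1l coch_comp1r coch_compA.

Lemma coch_mulP :
  circ (O := simplicial_operad) (erefl : (3 + 1 = 2 + 2)%N) coch_mul coch_mul
    = 0.
Proof.
apply: circ_mul_eq0; apply: funext => v.
have castE m n (e : m = n) (x : cochain m) :
    (forall w, x w = 1) ->
    forall w, (@cast_arity k simplicial_operad _ _ e x : cochain n) w = 1.
  by case: n / e.
have valE o : forall w : simplex (slot_arity (fun=> 2%N) o),
    (@slot_val k simplicial_operad 1 (fun=> 2%N) (fun=> coch_mul) o : cochain _)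
      w = 1 by case: o.
by rewrite !castE // => w; rewrite /= /coch_comp mul1r big1.
Qed.

Definition simplicial_operad_with_mul : operad_with_mul k :=
  OperadWithMul coch_mulP.

End SimplicialCochains.

Definition locally_finite (d : Order.disp_t) (P : porderType d) : Prop :=
  forall x y : P, finite_set [set z : P | (x <= z <= y)%O].

Section IncidenceSpace.
Variables (k : fieldType) (d : Order.disp_t) (P : porderType d).

Definition incidence_pred : {pred P -> P -> k^o} :=
  fun c => `[< forall i j : P, ~~ (i <= j)%O -> c i j = 0 >].

Lemma incidence_submod : submod_closed incidence_pred.
Proof.
split; first by apply/asboolP.
move=> c a b /asboolP aP /asboolP bP; apply/asboolP => i j ij.
by rewrite -[LHS]/(c * a i j + b i j) aP // bP // mulr0 addr0.
Qed.

(* The formal sum \sum_(i <= j) r_ij E^ij, possibly infinite, is represented  *)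
(* by its coefficients r_ij, extended by 0 to all pairs.                      *)
Record incidence := Incidence {
  coef :> P -> P -> k^o;
  _ : coef \in incidence_pred
}.

HB.instance Definition _ := [isSub for coef].
HB.instance Definition _ := [Choice of incidence by <:].
HB.instance Definition _ := GRing.SubChoice_isSubLmodule.Build
  k (P -> P -> k^o) incidence_pred incidence incidence_submod.

Lemma incidence_eq (a b : incidence) : (forall i j, a i j = b i j) -> a = b.
Proof.
by move=> ab; apply: val_inj; apply: funext => i; apply: funext => j.
Qed.

Lemma coef0 (a : incidence) (i j : P) : ~~ (i <= j)%O -> a i j = 0.
Proof. by case: a => a /= /asboolP; apply. Qed.

Lemma inc_mor_subproof (i j : P) :
  (fun x y : P => ([&& (i <= j)%O, x == i & y == j])%:R : k^o)
    \in incidence_pred.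
Proof.
by apply/asboolP => x y; case: and3P => // -[ij /eqP -> /eqP ->]; rewrite ij.
Qed.

(* E^ij if i <= j, and 0 otherwise.                                           *)
Definition inc_mor (i j : P) : incidence := Incidence (inc_mor_subproof i j).

Definition is_formal_sum (I : choiceType) (b : I -> incidence)
    (a : incidence) : Prop :=
  (forall i j : P, finite_set [set x | b x i j != 0]) /\
  (forall i j : P, a i j = \sum_(x \in [set: I]) b x i j).

End IncidenceSpace.

Section IncidenceAlgebra.
Variables (k : fieldType) (d : Order.disp_t) (P : porderType d).
Variable lf : locally_finite P.

Local Notation inc := (incidence k P).

Lemma inc_one_subproof :
  (fun x y : P => (x == y)%:R : k^o) \in @incidence_pred k d P.
Proof. by apply/asboolP => x y; case: eqP => // ->; rewrite lexx. Qed.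

Definition inc_one : inc := Incidence inc_one_subproof.

Definition inc_mul_coef (a b : inc) (i j : P) : k^o :=
  \sum_(l \in [set l : P | (i <= l <= j)%O]) (a i l : k) * (b l j : k).

Lemma inc_mul_subproof a b : inc_mul_coef a b \in @incidence_pred k d P.
Proof.
apply/asboolP => i j ij; apply: fsbig1 => l /= /andP[il lj].
by rewrite (le_trans il lj) in ij.
Qed.

Definition inc_mul (a b : inc) : inc := Incidence (inc_mul_subproof a b).

Let itv (i j : P) : seq P := enum_fset (fset_set [set l : P | (i <= l <= j)%O]).

Let mem_itv (i j l : P) : (l \in itv i j) = (i <= l <= j)%O.
Proof. by rewrite /itv in_fset_set ?mem_setE. Qed.

Let inc_mulE (a b : inc) (i j : P) (s : seq P) : uniq s ->
  (forall l, (i <= l <= j)%O -> l \in s) ->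
  inc_mul a b i j = \sum_(l <- s) (a i l : k) * (b l j : k).
Proof.
move=> us sP; apply: fsbig_fwiden => // l [ls /= nl].
by move: nl; case: (boolP (i <= l)%O) => [il lj|il _];
  rewrite ?(coef0 a il) ?mul0r // (coef0 b) ?mulr0 //; apply/negP.
Qed.

Let uitv i j : uniq (itv i j). Proof. exact: fset_uniq. Qed.

Lemma inc_mulA : associative inc_mul.
Proof.
move=> a b c; apply: incidence_eq => i j.
have sub l l' : (l <= l')%O -> (i <= l)%O -> (l' <= j)%O ->
    forall m, (l <= m <= l')%O -> m \in itv i j.
  move=> ll' il lj m /andP[lm ml]; rewrite mem_itv (le_trans il lm).
  exact: le_trans ml lj.
rewrite !(@inc_mulE _ _ i j (itv i j)) //; try by move=> l; rewrite mem_itv.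
transitivity (\sum_(l <- itv i j) \sum_(m <- itv i j)
   (a i l : k) * ((b l m : k) * (c m j : k))).
  apply: eq_big_seq => l; rewrite mem_itv => /andP[il lj].
  by rewrite (@inc_mulE _ _ _ _ (itv i j)) ?mulr_sumr //; apply: sub.
rewrite exchange_big; apply: eq_big_seq => m; rewrite mem_itv => /andP[im mj].
rewrite (@inc_mulE _ _ _ _ (itv i j)) ?mulr_suml //; last exact: sub.
by apply: eq_bigr => l _; rewrite mulrA.
Qed.

Let delta_sum (s : seq P) (F : P -> k) (x : P) : uniq s ->
  (x \notin s -> F x = 0) -> \sum_(l <- s) (x == l)%:R * F l = F x.
Proof.
move=> us Fx; case: (boolP (x \in s)) => xs; last first.
  rewrite Fx // big1_seq // => l /andP[_ ls].
  by case: eqP => [xl|]; rewrite ?mul0r //; rewrite xl ls in xs.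
rewrite (bigD1_seq x) //= eqxx mul1r big1 ?addr0 // => l.
by rewrite eq_sym => /negbTE ->; rewrite mul0r.
Qed.

Lemma inc_mul1l : left_id inc_one inc_mul.
Proof.
move=> a; apply: incidence_eq => i j.
rewrite (@inc_mulE _ _ i j (itv i j)) //; last by move=> l; rewrite mem_itv.
rewrite -[RHS](@delta_sum (itv i j) (fun l => a l j)) // mem_itv lexx /=.
exact: coef0.
Qed.

Lemma inc_mul1r : right_id inc_one inc_mul.
Proof.
move=> a; apply: incidence_eq => i j.
rewrite (@inc_mulE _ _ i j (itv i j)) //; last by move=> l; rewrite mem_itv.
rewrite -[RHS](@delta_sum (itv i j) (fun l => a i l)) //.
  by apply: eq_bigr => l _; rewrite mulrC eq_sym.
by rewrite mem_itv lexx andbT; exact: coef0.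
Qed.

Lemma inc_mul_linearl b : linear (fun a => inc_mul a b).
Proof.
move=> c a a'; apply: incidence_eq => i j.
rewrite -[RHS]/(c * inc_mul a b i j + inc_mul a' b i j).
rewrite !(@inc_mulE _ _ i j (itv i j)) //; try by move=> l; rewrite mem_itv.
rewrite mulr_sumr -big_split; apply: eq_bigr => l _ /=.
by rewrite -[X in X * _]/(c * a i l + a' i l) mulrDl mulrA.
Qed.

Lemma inc_mul_linearr a : linear (fun b => inc_mul a b).
Proof.
move=> c b b'; apply: incidence_eq => i j.
rewrite -[RHS]/(c * inc_mul a b i j + inc_mul a b' i j).
rewrite !(@inc_mulE _ _ i j (itv i j)) //; try by move=> l; rewrite mem_itv.
rewrite mulr_sumr -big_split; apply: eq_bigr => l _ /=.
by rewrite -[X in _ * X]/(c * b l j + b' l j) mulrDr mulrCA.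
Qed.

Definition incidence_algebra : algebra k :=
  @Algebra k inc inc_one inc_mul inc_mulA inc_mul1l inc_mul1r
    inc_mul_linearl inc_mul_linearr.

End IncidenceAlgebra.

Definition subalgebra (k : pzRingType) (A : algebra k) (B : set A) : Prop :=
  [/\ B (alg_one A),
      forall (c : k) (x y : A), B x -> B y -> B (c *: x + y) &
      forall x y : A, B x -> B y -> B (alg_mul x y)].

Definition formally_closed (k : fieldType) (d : Order.disp_t)
    (P : porderType d) (B : set (incidence k P)) : Prop :=
  forall (I : choiceType) (b : I -> incidence k P) (a : incidence k P),
    (forall x, B (b x)) -> is_formal_sum b a -> B a.

(* The elements of kP being possibly infinite formal sums, the subalgebra     *)
(* generated by the E^ii is the smallest subalgebra containing them that is   *)
(* closed under formal sums; this closure is vacuous if P is finite.          *)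
Definition identity_subalgebra (k : fieldType) (d : Order.disp_t)
    (P : porderType d) (lf : locally_finite P) :
    set (incidence_algebra k lf) :=
  smallest
    [set B : set (incidence_algebra k lf) | subalgebra B /\ formally_closed B]%classic
    (range (fun i : P => inc_mor k i i)).

Arguments identity_subalgebra k {d P} lf _.

Lemma identity_subalgebraE (k : fieldType) (d : Order.disp_t)
    (P : porderType d) (lf : locally_finite P) (a : incidence_algebra k lf) :
  identity_subalgebra k lf a <->
  (forall i j : P, i != j -> (a : incidence k P) i j = 0).
Proof.
split=> [|diag]; last first.
  move=> B /= [[[_ Blin _] Bclosed] BE].
  have B0 : B 0.
    apply: (Bclosed void (fun x => match x with end)) => //; split=> i j.
      exact: finite_finset.
    by rewrite -[LHS]/(0 : k) fsbig1.
  have bE (x i j : P) : (((a : incidence k P) x x : k) *: inc_mor k x x) i j =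
      if (x == i) && (x == j) then (a : incidence k P) i j else 0.
    rewrite -[LHS]/((a : incidence k P) x x *
      ([&& (x <= x)%O, i == x & j == x])%:R) lexx /= !(eq_sym x).
    by case: eqP => [->|_]; case: eqP => [->|_]; rewrite ?mulr1 ?mulr0.
  apply: (Bclosed P (fun x : P => ((a : incidence k P) x x : k) *: inc_mor k x x)).
    by move=> x; rewrite -[X in B X]addr0; apply: Blin => //; apply: BE; exists x.
  split=> i j.
    apply: (@sub_finite_set _ _ [set i]); last exact: finite_set1.
    by move=> x; rewrite /mkset bE; case: (x =P i) => [->|_] /=; rewrite ?eqxx.
  rewrite -(@fsbig_widen _ _ _ _ [set i]) ?fsbig_set1 //; last first.
    by move=> x [_ xi]; rewrite /preimage /mkset bE; case: eqP xi.
  rewrite bE eqxx /=; case: eqP => // /eqP; exact: diag.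
pose D := [set s : incidence_algebra k lf |
  forall i j : P, i != j -> (s : incidence k P) i j = 0]%classic.
move=> /(_ D); apply; split; last first.
  move=> _ [x _ <-] i j ij /=.
  by case: and3P => // -[_ /eqP xi /eqP xj]; rewrite xi xj eqxx in ij.
split.
- split=> [i j /negbTE /= -> //|c x y Hx Hy i j ij|x y Hx Hy i j ij].
    by rewrite -[LHS]/(c * x i j + y i j) Hx // Hy // mulr0 addr0.
  apply: fsbig1 => l _; case: (eqVneq i l) => [il|il]; last by rewrite Hx // mul0r.
  by rewrite [X in _ * X]Hy ?mulr0 // -il.
- move=> I b x Hb [_ xE] i j ij; rewrite xE; apply: fsbig1 => t _.
  exact: Hb.
Qed.

Definition simplicial_hG (k : fieldType) (d : Order.disp_t)
    (P : porderType d) : hG_structure k :=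
  derived_hG (simplicial_operad_with_mul k P).

Definition hochschild_hG (k : fieldType) (d : Order.disp_t)
    (P : porderType d) (lf : locally_finite P) : hG_structure k :=
  derived_hG (hochschild_operad_with_mul (identity_subalgebra k lf)).

Definition point_simplex (d : Order.disp_t) (P : porderType d) (i : P) :
    simplex P 0 :=
  @Simplex d P 0 (fun=> i) (fun _ _ _ => lexx i).

Record is_Phi (k : fieldType) (d : Order.disp_t) (P : porderType d)
    (lf : locally_finite P)
    (Phi : forall n, cochain k P n -> hochschild (identity_subalgebra k lf) n) :
    Prop := IsPhi {
  Phi_zero : forall (f : cochain k P 0) (v : 'I_0 -> incidence_algebra k lf),
    is_formal_sum (fun i : P => (f (point_simplex i) : k) *: inc_mor k i i)
                  (Phi 0 f v);
  Phi_pos : forall n (f : cochain k P n) (i : simplex P n), (0 < n)%N ->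
    Phi n f (fun l : 'I_n =>
               inc_mor k (i (widen_ord (leqnSn n) l)) (i (lift ord0 l))) =
    (f i : k) *: inc_mor k (i ord0) (i ord_max)
}.

(* Main.v *)
(* Evaluating a relative cochain F on the tuples (E^{i0 i1}, ..., E^{in-1 in}) *)
(* gives a left inverse Psi of Phi.  Its kernel is zero: to compute the        *)
(* (x, y)-coefficient of F(v), the elements of S cut each argument down to     *)
(* indices in the finite interval [x, y], where it is a finite combination of  *)
(* morphisms, the rest of the argument being pushed to the right by an         *)
(* infinite diagonal sum in S and annihilated there.  So Phi is bijective, and *)
(* compatibility with operadic composition may be tested after applying Psi,   *)
(* where only one path contributes.  The hG-operations are natural for         *)
(* morphisms of operads with multiplication.                                   *)
Require Import Defs.
From mathcomp Require Import all_boot all_order all_algebra.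
From mathcomp Require Import finmap.
From mathcomp Require Import boolp classical_sets functions cardinality fsbigop.

Set Implicit Arguments.
Unset Strict Implicit.
Unset Printing Implicit Defensive.

Import Order.TTheory GRing.Theory.

Local Open Scope ring_scope.

(** Relative cochains are balanced over the idempotents [E^ii]. On a tuple
    [E^{i0 i1}, ..., E^{i(n-1) in}] such a cochain can therefore have a nonzero coefficient only at
    [(i0, in)], which leaves one scalar per simplex; [Psi] reads it off. Conversely, for a
    simplicial cochain [f], the [(x, y)]-coefficient of [Phi f] is the sum, over paths [u] from [x]
    to [y], of [f u] times the coefficients of the arguments along [u].

    [Phi_mors] gives that [Psi] after [Phi] is the identity, and [Psi_eq0] that [Psi] is injective.
    The delicate point is that arguments are infinite formal sums while multilinearity splits only
    finite ones: [row_decomp] isolates a finite part, and [hoch_upclosed_eq0] kills the tail.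

    [Phi_id], [Phi_comp] and [Phi_mul] then make [Phi] an isomorphism of operads with
    multiplication, and [operad_iso_hG_iso] transports the derived operations. *)

(** * Naturality of the hG-operations under operad morphisms *)

Section OperadMorphism.
Variables (k : fieldType) (O Q : operad_with_mul k) (phi : forall n, O n -> Q n).
Hypothesis phi_lin : forall n, linear (@phi n).
Hypothesis phi_id : phi (op_id O) = op_id Q.
Hypothesis phi_comp : forall r (a : 'I_r -> nat) (x : O r)
  (y : forall i, O (a i)),
  phi (op_comp x y) = op_comp (phi x) (fun i => phi (y i)).
Hypothesis phi_mul : phi (om_mul O) = om_mul Q.

Lemma operad_morph0 n : phi (0 : O n) = 0.
Proof.
by have := phi_lin (-1) (0 : O n) 0; rewrite scaler0 addr0 scaleN1r addNr.
Qed.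

Lemma operad_morphD n : {morph @phi n : x y / x + y}.
Proof. by move=> x y; have := phi_lin 1 x y; rewrite !scale1r. Qed.

Lemma operad_morphZ n c : {morph @phi n : x / c *: x}.
Proof.
by move=> x; have := phi_lin c x 0; rewrite operad_morph0 !addr0.
Qed.

Lemma operad_morph_cast m n (e : m = n) (x : O m) :
  phi (cast_arity e x) = cast_arity e (phi x).
Proof. by case: n / e. Qed.

Lemma operad_morph_slot n (a : 'I_n -> nat) (y : forall l, O (a l)) o :
  phi (slot_val y o) = slot_val (fun l => phi (y l)) o.
Proof. by case: o. Qed.

(** The shuffles, signs and casts depend on the arities alone; the rest is composition with the
    [y l] and [op_id]. *)
Lemma operad_morph_brace r n (a : 'I_n -> nat) N
    (e : (N + n = r + \sum_(l < n) a l)%N) (x : O r) (y : forall l, O (a l)) :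
  phi (brace e x y) = brace e (phi x) (fun l => phi (y l)).
Proof.
rewrite /brace (big_morph _ (@operad_morphD N) (operad_morph0 N)).
apply: eq_bigr => h _; rewrite operad_morphZ operad_morph_cast phi_comp.
congr (_ *: cast_arity _ (op_comp _ _)).
by apply: functional_extensionality_dep => j; exact: operad_morph_slot.
Qed.

Lemma operad_morph_dot m n (x : O m) (y : O n) :
  phi (op_dot x y) = op_dot (phi x) (phi y).
Proof.
rewrite /op_dot operad_morphZ operad_morph_brace phi_mul.
congr (_ *: brace _ _ _).
(* [pair_val] computes only once the index is split into the first and the second one. *)
by apply: functional_extensionality_dep => -[[|i] p].
Qed.

Lemma operad_morph_diff n (x : O n) : phi (op_diff x) = op_diff (phi x).
Proof.
rewrite /op_diff /op_shifted_diff -!scaleN1r !(operad_morphZ, operad_morphD).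
by rewrite /circ !operad_morph_brace phi_mul.
Qed.

Lemma operad_iso_hG_iso (phi_bij : forall n, bijective (@phi n)) :
  @hG_isomorphism k (derived_hG O) (derived_hG Q) phi.
Proof.
split=> //; [exact: operad_morph_brace | exact: operad_morph_dot |].
exact: operad_morph_diff.
Qed.

End OperadMorphism.

(** * Action of the diagonal subalgebra on coefficients *)

Section Phi.
Variables (k : fieldType) (d : Order.disp_t) (P : porderType d).
Variable lf : locally_finite P.

Local Notation A := (incidence_algebra k lf).
Local Notation S := (identity_subalgebra k lf).
Local Notation inc := (incidence k P).
Local Notation "x ** y" := (@alg_mul k A x y) (at level 40, left associativity).

(** By [identity_subalgebraE], [b] is diagonal, so only the intermediate index [x] contributes to
    the product. *)
Lemma mul_diagl (b a : A) (x y : P) :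
  S b -> (b ** a : inc) x y = ((b : inc) x x : k) * ((a : inc) x y : k).
Proof.
move=> /identity_subalgebraE diag; rewrite -[LHS]/(inc_mul_coef _ _ _ _).
case: (boolP (x <= y)%O) => [xy|xy]; last first.
  rewrite (Defs.coef0 a xy) mulr0; apply: fsbig1 => l /= /andP[xl ly].
  by rewrite (le_trans xl ly) in xy.
rewrite /inc_mul_coef -(@fsbig_widen _ _ _ _ [set x]%classic) ?fsbig_set1 //.
  by move=> l /= ->; rewrite lexx.
by move=> l [_ /eqP xl] /=; rewrite diag ?mul0r // eq_sym.
Qed.

Lemma mul_diagr (b a : A) (x y : P) :
  S b -> (a ** b : inc) x y = ((a : inc) x y : k) * ((b : inc) y y : k).
Proof.
move=> /identity_subalgebraE diag; rewrite -[LHS]/(inc_mul_coef _ _ _ _).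
case: (boolP (x <= y)%O) => [xy|xy]; last first.
  rewrite (Defs.coef0 a xy) mul0r; apply: fsbig1 => l /= /andP[xl ly].
  by rewrite (le_trans xl ly) in xy.
rewrite /inc_mul_coef -(@fsbig_widen _ _ _ _ [set y]%classic) ?fsbig_set1 //.
  by move=> l /= ->; rewrite lexx andbT.
by move=> l [_ /eqP xl] /=; rewrite [X in _ * X]diag ?mulr0.
Qed.

(** * Path sums and the construction of [Phi] *)

Definition interval (x y : P) : {fset P} :=
  fset_set [set z : P | (x <= z <= y)%O]%classic.

Lemma in_interval (x y z : P) : (z \in interval x y) = (x <= z <= y)%O.
Proof. by rewrite /interval in_fset_set ?mem_setE. Qed.

(** Extension by 0 lets path sums range over all tuples of vertices; a tuple that is not a chain has
    weight 0 anyway. *)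
Definition cochain_ext n (f : cochain k P n) (u : 'I_n.+1 -> P) : k :=
  if pselect (forall i j : 'I_n.+1, (i <= j)%N -> (u i <= u j)%O) is left h
  then f (Simplex h) else 0.

Lemma cochain_extE n (f : cochain k P n) (w : simplex P n) u :
  u =1 w -> cochain_ext f u = f w.
Proof.
move=> /funext ->; rewrite /cochain_ext; case: pselect => [h|[]].
  by congr f; apply: simplex_eq.
exact: simplex_mono.
Qed.

Definition path_weight n (a : 'I_n -> A) (u : 'I_n.+1 -> P) : k :=
  \prod_(l < n) ((a l : inc) (u (widen_ord (leqnSn n) l)) (u (lift ord0 l)) : k).

Lemma path_weight_with n (v : 'I_n -> A) (i : 'I_n) (c : A) u :
  path_weight [eta v with i |-> c] u =
  (c : inc) (u (widen_ord (leqnSn n) i)) (u (lift ord0 i)) *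
  \prod_(l < n | l != i)
    ((v l : inc) (u (widen_ord (leqnSn n) l)) (u (lift ord0 l)) : k).
Proof.
rewrite /path_weight (bigD1 i) //= eqxx; congr (_ * _).
by apply: eq_bigr => l /negbTE ->.
Qed.

Lemma path_weightD1 n (v : 'I_n -> A) (i : 'I_n) u :
  path_weight v u =
  ((v i : inc) (u (widen_ord (leqnSn n) i)) (u (lift ord0 i)) : k) *
  \prod_(l < n | l != i)
    ((v l : inc) (u (widen_ord (leqnSn n) l)) (u (lift ord0 l)) : k).
Proof. by rewrite /path_weight (bigD1 i). Qed.

Lemma path_weight_mull n (v : 'I_n -> A) (i : 'I_n) b u : S b ->
  path_weight [eta v with i |-> b ** v i] u =
  ((b : inc) (u (widen_ord (leqnSn n) i)) (u (widen_ord (leqnSn n) i)) : k)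
    * path_weight v u.
Proof.
by move=> Sb; rewrite path_weight_with (path_weightD1 v i) mul_diagl // mulrA.
Qed.

Lemma path_weight_mulr n (v : 'I_n -> A) (i : 'I_n) b u : S b ->
  path_weight [eta v with i |-> v i ** b] u =
  ((b : inc) (u (lift ord0 i)) (u (lift ord0 i)) : k) * path_weight v u.
Proof.
move=> Sb; rewrite path_weight_with (path_weightD1 v i) mul_diagr //.
by rewrite mulrA [X in X * _]mulrC.
Qed.

(* The vertices of a path from x to y all lie in [x, y], so the sum is finite. *)
Definition path_sum n (f : cochain k P n) (v : 'I_n -> A) (x y : P) : k^o :=
  \sum_(u : {ffun 'I_n.+1 -> interval x y} |
         (val (u ord0) == x) && (val (u ord_max) == y))
    cochain_ext f (fun i => val (u i)) * path_weight v (fun i => val (u i)).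

Lemma path_sum_subproof n (f : cochain k P n) v :
  path_sum f v \in @incidence_pred k d P.
Proof.
apply/asboolP => x y xy; apply: big1 => u _.
have := fsvalP (u ord0); rewrite in_interval => /andP[xu uy].
by rewrite (le_trans xu uy) in xy.
Qed.

Definition Phi_fun n (f : cochain k P n) (v : 'I_n -> A) : A :=
  Incidence (path_sum_subproof f v).

(** A diagonal factor [b] on an argument multiplies the weight of a path by an entry of [b] at one
    vertex. A right factor on one argument and a left factor on the next one meet at the same
    vertex; the outermost vertices are [x] and [y]. *)
Lemma Phi_relative n (f : cochain k P n) :
  Phi_fun f \in @relative_pred k A S n.
Proof.
apply/asboolP; split.
- move=> v i c a b; apply: incidence_eq => x y.
  rewrite -[RHS]/(c * path_sum _ _ _ _ + path_sum _ _ _ _) mulr_sumr -big_split.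
  apply: eq_bigr => u _; rewrite /= !path_weight_with.
  rewrite -[X in _ * (X * _)]/(c * (a : inc) _ _ + (b : inc) _ _) mulrDl mulrDr.
  by rewrite -[in LHS]mulrA mulrCA.
- move=> b Sb v i i0; apply: incidence_eq => x y.
  rewrite mul_diagl // [RHS]mulr_sumr; apply: eq_bigr => u /andP[/eqP ux _].
  rewrite path_weight_mull // mulrCA; congr (_ * _).
  by rewrite (_ : widen_ord _ i = ord0) ?ux //; apply: val_inj.
- move=> b Sb v i j ij; apply: incidence_eq => x y; apply: eq_bigr => u _.
  rewrite path_weight_mull // path_weight_mulr //.
  by rewrite (_ : widen_ord _ j = lift ord0 i) //; apply: val_inj.
- move=> b Sb v i i_n; apply: incidence_eq => x y.
  rewrite mul_diagr // [RHS]mulrC [RHS]mulr_sumr.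
  apply: eq_bigr => u /andP[_ /eqP uy].
  rewrite path_weight_mulr // mulrCA; congr (_ * _).
  by rewrite (_ : lift ord0 i = ord_max) ?uy //; apply: val_inj.
- move=> n0 b Sb v; apply: incidence_eq => x y.
  rewrite (mul_diagl _ _ _ Sb) (mul_diagr _ _ _ Sb).
  case: (eqVneq x y) => [->|xy]; first exact: mulrC.
  (* In degree 0 a path is a single vertex, so none joins [x] to a different [y]. *)
  rewrite -[_ x y]/(path_sum f v x y) /path_sum big_pred0 ?mulr0 ?mul0r // => u.
  rewrite (_ : ord_max = ord0); last exact: val_inj.
  by case: eqP => // ->; exact/negbTE.
Qed.

Definition Phi n (f : cochain k P n) : hochschild S n :=
  Hochschild (Phi_relative f).

Lemma Phi_single_path n (f : cochain k P n) (v : 'I_n -> A) (w : simplex P n) :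
  (forall u : 'I_n.+1 -> P, u ord0 = w ord0 -> u ord_max = w ord_max ->
     path_weight v u != 0 -> u =1 w) ->
  (Phi f v : inc) (w ord0) (w ord_max) = f w * path_weight v w.
Proof.
move=> single.
have wP i : w i \in interval (w ord0) (w ord_max).
  by rewrite in_interval !simplex_mono // -ltnS.
pose u0 : {ffun 'I_n.+1 -> interval (w ord0) (w ord_max)} :=
  [ffun i => [` wP i]%fset].
have u0E : (fun i => val (u0 i)) = w by apply: funext => i; rewrite ffunE.
rewrite -[LHS]/(path_sum _ _ _ _) /path_sum (bigD1 u0) /=; last first.
  by rewrite !ffunE /= !eqxx.
rewrite u0E (@cochain_extE _ f w) // big1 ?addr0 // => u.
case/andP=> /andP[/eqP ux /eqP uy] uu0.
case: (eqVneq (path_weight v (fun i => val (u i))) 0) => [->|nz].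
  by rewrite mulr0.
case/eqP: uu0; apply/ffunP => i; apply: val_inj.
by rewrite (single _ ux uy nz) ffunE.
Qed.

(** * Evaluation on the morphisms along a simplex *)

Definition simplex_mors n (i : simplex P n) (l : 'I_n) : A :=
  inc_mor k (i (widen_ord (leqnSn n) l)) (i (lift ord0 l)).

Lemma simplex_step n (i : simplex P n) (l : 'I_n) :
  (i (widen_ord (leqnSn n) l) <= i (lift ord0 l))%O.
Proof. by apply: simplex_mono => /=; rewrite /bump leq0n add1n leqnSn. Qed.

Lemma simplex_mors_weight n (i : simplex P n) :
  path_weight (simplex_mors i) i = 1.
Proof.
by apply: big1 => l _ /=; rewrite simplex_step !eqxx.
Qed.

(** The target of each morphism fixes the next vertex of [u]; the initial vertex has to be given,
    since no morphism fixes it when [n] is 0. *)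
Lemma simplex_mors_path n (i : simplex P n) (u : 'I_n.+1 -> P) :
  path_weight (simplex_mors i) u != 0 -> u ord0 = i ord0 -> u =1 i.
Proof.
move=> /prodf_neq0 nz u0; have step (l : 'I_n) :
    u (lift ord0 l) = i (lift ord0 l).
  by have := nz l isT; rewrite /=; case: and3P => [[_ _ /eqP]|]; rewrite ?eqxx.
by move=> j; case: (unliftP ord0 j) => [l ->|-> //]; exact: step.
Qed.

Lemma Phi_mors n (f : cochain k P n) (i : simplex P n) :
  (Phi f (simplex_mors i) : inc) (i ord0) (i ord_max) = f i.
Proof.
rewrite Phi_single_path ?simplex_mors_weight ?mulr1 // => u u0 _ nz.
exact: simplex_mors_path.
Qed.

Lemma path_sum_neq0 n (f : cochain k P n) (v : 'I_n -> A) x y :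
  (Phi f v : inc) x y != 0 ->
  exists u : 'I_n.+1 -> P,
    [/\ u ord0 = x, u ord_max = y & path_weight v u != 0].
Proof.
move=> nz; apply: contrapT => nu; case/eqP: nz; apply: big1 => u.
case/andP=> /eqP u0 /eqP un.
case: (eqVneq (path_weight v (fun i => val (u i))) 0) => [->|nz].
  by rewrite mulr0.
by case: nu; exists (fun i => val (u i)).
Qed.


(** * Injectivity of [Psi] by cutting with idempotents *)

Lemma diag_subproof (U : pred P) :
  (fun x y : P => ((x == y) && U x)%:R : k^o) \in @incidence_pred k d P.
Proof. by apply/asboolP => x y; case: eqP => // ->; rewrite lexx. Qed.

(** The idempotent [D_U], the sum of [E^ii] over [U]. It may be infinite, and lies in [S] because
    [S] is closed under formal sums. *)
Definition diag (U : pred P) : A := Incidence (diag_subproof U).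

Lemma diag_in U : S (diag U).
Proof. by apply/identity_subalgebraE => x y /= /negbTE ->. Qed.

Lemma diag_mull U (a : A) x y :
  (diag U ** a : inc) x y = (U x)%:R * ((a : inc) x y : k).
Proof. by rewrite (mul_diagl _ _ _ (diag_in U)) /= eqxx. Qed.

Lemma diag_mulr U (a : A) x y :
  (a ** diag U : inc) x y = ((a : inc) x y : k) * (U y)%:R.
Proof. by rewrite (mul_diagr _ _ _ (diag_in U)) /= eqxx. Qed.

Lemma with_id n (v : 'I_n -> A) (i : 'I_n) :
  [eta v with i |-> v i] = v :> ('I_n -> A).
Proof. by apply: funext => j /=; case: eqP => [->|]. Qed.

Lemma with_with n (v : 'I_n -> A) (i : 'I_n) (a b : A) :
  [eta [eta v with i |-> a] with i |-> b] = [eta v with i |-> b]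
    :> ('I_n -> A).
Proof. by apply: funext => j /=; case: eqP. Qed.

(* If U is up-closed then D_U a = D_U a D_U, so that D_U can be pushed through *)
(* all the arguments to the right.                                             *)
Lemma hoch_upclosed_eq0 n (F : hochschild S n) (U : pred P) (x y : P)
    (v : 'I_n -> A) (i : 'I_n) :
  (forall z w : P, (z <= w)%O -> U z -> U w) -> ~~ U y ->
  (F [eta v with i |-> v i ** diag U] : inc) x y = 0.
Proof.
move=> Uup Uy; have [m] := ubnP (n - i); elim: m i v => // m IH i v nim.
(* After the last argument [D_U] leaves on the right and kills the column [y], which is outside
   [U]. *)
case: (ltnP i.+1 n) => [lt|ge]; last first.
  rewrite (rel_right (hochschildP F) (diag_in U)) ?diag_mulr.
    by rewrite (negbTE Uy) mulr0.
  by apply/eqP; rewrite eqn_leq ge ltn_ord.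
rewrite (rel_mid (hochschildP F) (diag_in U) v (j := Ordinal lt)) //.
set j := Ordinal lt; set w : 'I_n -> A := [eta v with j |-> diag U ** v j].
have -> : w = [eta w with j |-> w j ** diag U] :> ('I_n -> A).
  suff <- : w j = w j ** diag U by rewrite with_id.
  apply: incidence_eq => s t; rewrite diag_mulr /w /= eqxx diag_mull.
  case: (boolP (U s)) => Us; last by rewrite !mul0r.
  case: (boolP (s <= t)%O) => st; first by rewrite (Uup s) // mulr1.
  by rewrite (Defs.coef0 (v j : inc) st) !mulr0 mul0r.
by apply: IH; rewrite /= subnS -ltnS prednK // subn_gt0.
Qed.

(** This cuts argument [i] down to its row [j i]. The preceding morphism ends at [j i], hence
    absorbs the idempotent there, which moves across by balance; for [i = 0] the left action just
    selects the row [x]. *)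
Lemma hoch_insert n (F : hochschild S n) (x y : P) (v : 'I_n -> A) (i : 'I_n)
    (j : nat -> P) :
  j 0%N = x ->
  (forall l : 'I_n, (l < i)%N -> v l = inc_mor k (j l) (j l.+1)) ->
  (F [eta v with i |-> diag (pred1 (j i)) ** v i] : inc) x y =
  (F v : inc) x y.
Proof.
move=> j0 vE; have Si := diag_in (pred1 (j i)).
case: (posnP i) => [i0|i0].
  rewrite (rel_left (hochschildP F) Si) // diag_mull i0 j0 /=.
  by rewrite eqxx mul1r.
have lt : (i.-1 < n)%N by rewrite (leq_ltn_trans (leq_pred i)).
have iE : i = (Ordinal lt).+1 :> nat by rewrite /= prednK.
rewrite -(rel_mid (hochschildP F) Si v (i := Ordinal lt)) //.
set q := Ordinal lt in iE *.
have -> : v q ** diag (pred1 (j i)) = v q; last by rewrite with_id.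
apply: incidence_eq => s t; rewrite diag_mulr vE ?iE //=.
by case: and3P => [[_ _ /eqP ->]|_]; rewrite ?eqxx ?mul0r ?mulr1.
Qed.

(** The row of [x] is split according to whether the column lies below [y]. The first part is finite
    by local finiteness; the second is supported on an up-closed set that avoids [y], as
    [hoch_upclosed_eq0] requires. *)
Lemma row_decomp (a : A) (x y : P) :
  diag (pred1 x) ** a =
  \sum_(z <- interval x y) ((a : inc) x z : k) *: (inc_mor k x z : A)
  + (diag (pred1 x) ** a) ** diag (fun z => ~~ (z <= y)%O).
Proof.
apply: incidence_eq => s t.
rewrite -[RHS]/((_ : inc) s t + (_ ** _ : inc) s t) diag_mulr diag_mull /=.
rewrite (big_morph (fun b : A => (b : inc) s t : k) (id1 := 0)
  (op1 := +%R)) //=.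
pose G z : k := ((a : inc) x z : k) * ([&& (x <= z)%O, s == x & t == z])%:R.
rewrite (eq_bigr G) //; case: (eqVneq s x) => [sx|sx]; last first.
  by rewrite !mul0r addr0 big1 // => z _; rewrite /G (negbTE sx) andbF mulr0.
case: (boolP (t \in interval x y)) => txy.
  rewrite (bigD1_seq t) ?fset_uniq //= big1 => [|z /negbTE zt]; last first.
    by rewrite /G [t == z]eq_sym zt !andbF mulr0.
  move: txy; rewrite in_interval => /andP[xt ty].
  by rewrite /G sx xt !eqxx ty mul1r mulr1 mulr0 !addr0.
rewrite big1_seq => [|z /andP[_ zI]]; last first.
  rewrite /G; case: (eqVneq t z) => [tz|]; last by rewrite !andbF mulr0.
  by rewrite tz zI in txy.
rewrite add0r sx !mul1r; move: txy; rewrite in_interval.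
case: (boolP (x <= t)%O) => [_ /= ->|xt _]; first by rewrite mulr1.
by rewrite Defs.coef0 ?mul0r.
Qed.

Definition Psi n (F : hochschild S n) : cochain k P n :=
  fun i => (F (simplex_mors i) : inc) (i ord0) (i ord_max).

Lemma nat_chain_mono (j : nat -> P) n :
  (forall l, (l < n)%N -> (j l <= j l.+1)%O) ->
  forall p q, (p <= q)%N -> (q <= n)%N -> (j p <= j q)%O.
Proof.
move=> step p q; elim: q => [|q IH]; first by rewrite leqn0 => /eqP ->.
rewrite leq_eqVlt => /orP[/eqP -> //|pq qn].
by apply: le_trans (step q qn); apply: IH => //; exact: ltnW.
Qed.

(** At [y = j n] this is the vanishing of [Psi F]. Otherwise the idempotent at [j n] is absorbed by
    the last morphism and leaves on the right, killing the column [y]; in degree 0, commutation with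
    [E^xx] does it. *)
Lemma hoch_chain_eq0 n (F : hochschild S n) (x y : P) (v : 'I_n -> A)
    (j : nat -> P) :
  Psi F = 0 -> j 0%N = x ->
  (forall l, (l < n)%N -> (j l <= j l.+1)%O) ->
  (forall l : 'I_n, v l = inc_mor k (j l) (j l.+1)) -> (F v : inc) x y = 0.
Proof.
move=> PF j0 jm vE.
have wP (s t : 'I_n.+1) : (s <= t)%N -> (j s <= j t)%O.
  by move=> st; apply: nat_chain_mono st _; [exact: jm | rewrite -ltnS].
case: (eqVneq y (j n)) => [yj|ne].
  have := congr1 (fun f : cochain k P n => f (Simplex wP)) PF.
  rewrite /Psi /= j0 -yj => PF0; rewrite -[RHS]PF0.
  congr ((hoch_fun F _ : inc) x y).
  by apply: funext => l; rewrite vE /simplex_mors /=.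
case: (posnP n) => [n0|n0].
  have := congr1 (fun a : A => (a : inc) x y)
    (rel_zero (hochschildP F) n0 (diag_in (pred1 x)) v).
  rewrite diag_mulr diag_mull /= eqxx mul1r => <-.
  by rewrite -j0 -{2}n0 (negbTE ne) mulr0.
have lt : (n.-1 < n)%N by rewrite ltn_predL.
have := rel_right (hochschildP F) (diag_in (pred1 (j n))) v
  (i := Ordinal lt) (prednK n0).
rewrite (_ : v _ ** _ = v (Ordinal lt)).
  by rewrite with_id => ->; rewrite diag_mulr /= (negbTE ne) mulr0.
apply: incidence_eq => s t; rewrite diag_mulr vE /= prednK //.
by case: and3P => [[_ _ /eqP ->]|_]; rewrite ?eqxx ?mul0r ?mulr1.
Qed.

Lemma Psi_eq0 n (F : hochschild S n) : Psi F = 0 -> F = 0.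
Proof.
move=> PF; apply: hochschild_eq => v; apply: incidence_eq => x y.
rewrite -[RHS]/(0 : k).
(* Induction on the number [m] of arguments still arbitrary; the first [p] already form a chain of
   morphisms starting at [x]. *)
suff main m : forall p v (j : nat -> P), (p + m = n)%N -> j 0%N = x ->
    (forall l, (l < p)%N -> (j l <= j l.+1)%O) ->
    (forall l : 'I_n, (l < p)%N -> v l = inc_mor k (j l) (j l.+1)) ->
    (F v : inc) x y = 0.
  exact: (main n 0%N v (fun=> x)).
elim: m => [|m IH] p {}v j.
  rewrite addn0 => -> j0 jm vE; apply: (hoch_chain_eq0 y PF j0 jm) => l.
  exact: vE.
move=> pn j0 jm vE; have lt : (p < n)%N by rewrite -pn addnS ltnS leq_addr.
set i : 'I_n := Ordinal lt.
rewrite -(@hoch_insert n F x y v i j) // (row_decomp _ _ y).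
pose K a : k := (F [eta v with i |-> a] : inc) x y.
have Klin c a b : K (c *: a + b) = c * K a + K b.
  by rewrite /K (rel_multilinear (hochschildP F)).
have K0 : K 0 = 0 by have := Klin (-1) 0 0; rewrite scaler0 addr0 mulN1r addNr.
rewrite -[LHS]/(K _) -[X in K (X + _)]scale1r Klin mul1r.
have -> : K ((diag (pred1 (j p)) ** v i) ** diag (fun z => ~~ (z <= y)%O)) = 0.
  set a := diag _ ** v i.
  have := @hoch_upclosed_eq0 n F (fun z => ~~ (z <= y)%O) x y
    [eta v with i |-> a] i.
  rewrite with_with /= eqxx; apply; last by rewrite lexx.
  by move=> z w zw; apply: contraNN; exact: le_trans.
rewrite addr0 big_seq.
elim/big_rec: _ => // z a; rewrite in_interval => /andP[jz zy] Ka.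
rewrite Klin Ka addr0; apply/eqP; rewrite mulf_eq0; apply/orP; right; apply/eqP.
(* The chain is prolonged by [z], the target of the morphism now in place [p]. *)
pose j' l := if (l <= p)%N then j l else z.
apply: (IH p.+1 _ j') => //; first by rewrite addSnnS.
  move=> l; rewrite ltnS /j' => lp; rewrite lp; case: (ltnP l p) => [|pl].
    exact: jm.
  by rewrite (_ : l = p) //; apply/eqP; rewrite eqn_leq lp.
move=> l; rewrite ltnS /j' => lp /=; rewrite lp.
case: eqP => [->|li] /=; first by rewrite ltnn.
rewrite ltn_neqAle lp andbT; case: eqP => [lpE|_] /=; last first.
  rewrite vE // ltn_neqAle lp andbT; apply/eqP => lpE.
  by apply: li; apply: val_inj.
by case: li; apply: val_inj.
Qed.

(** * Bijectivity and linearity of [Phi] *)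

Lemma Psi_linear n : linear (@Psi n).
Proof.
move=> c F G; apply: funext => i.
have FG v : (c *: F + G) v = c *: F v + G v by [].
by transitivity (c * (Psi F i : k) + (Psi G i : k)); first rewrite [LHS]/Psi FG.
Qed.

Lemma Psi_inj n : injective (@Psi n).
Proof.
move=> F G FG; apply/esym/subr0_eq/Psi_eq0.
by rewrite addrC -scaleN1r Psi_linear FG scaleN1r addNr.
Qed.

Lemma PhiK n : cancel (@Phi n) (@Psi n).
Proof. by move=> f; apply: funext => i; exact: Phi_mors. Qed.

Lemma Phi_bij n : bijective (@Phi n).
Proof.
by exists (@Psi n); [exact: PhiK | exact: inj_can_sym (@PhiK n) (@Psi_inj n)].
Qed.

Lemma Phi_linear n : linear (@Phi n).
Proof. by move=> c f g; apply: Psi_inj; rewrite Psi_linear !PhiK. Qed.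

(** * Compatibility with the operad structures, tested after [Psi] *)

Lemma Phi_id : Phi (@coch_id k d P) = hoch_id S.
Proof.
apply: Psi_inj; rewrite PhiK; apply: funext => i.
rewrite /Psi -[RHS]/((simplex_mors i ord0 : inc) _ _) /simplex_mors.
have -> : widen_ord (leqnSn 1) ord0 = ord0 by exact: val_inj.
have -> : lift ord0 ord0 = ord_max :> 'I_2 by exact: val_inj.
by rewrite /= (simplex_mono i) // !eqxx.
Qed.

Lemma Phi_mul : Phi (@coch_mul k d P) = hoch_mul S.
Proof.
apply: Psi_inj; rewrite PhiK; apply: funext => i.
pose i1 := i (lift ord0 ord0).
have i01 : (i ord0 <= i1)%O by apply: simplex_mono.
have i12 : (i1 <= i ord_max)%O by apply: simplex_mono.
have E0 l : (simplex_mors i ord0 : inc) (i ord0) l = (l == i1)%:R.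
  rewrite /simplex_mors /= (_ : widen_ord _ _ = ord0); last exact: val_inj.
  by rewrite i01 eqxx.
have E1 : (simplex_mors i ord_max : inc) i1 (i ord_max) = 1.
  rewrite /simplex_mors /=.
  rewrite (_ : widen_ord _ _ = lift ord0 ord0); last exact: val_inj.
  rewrite (_ : lift ord0 (ord_max : 'I_2) = ord_max :> 'I_3) ?i12 ?eqxx //.
  exact: val_inj.
apply/esym; rewrite -[LHS]/(inc_mul_coef _ _ _ _) /inc_mul_coef.
(* The first morphism ends at [i1], so no other intermediate index contributes. *)
rewrite -(@fsbig_widen _ _ _ _ [set i1]%classic).
- by rewrite fsbig_set1 E0 E1 eqxx mul1r.
- by move=> _ ->; rewrite /= i01.
by move=> l [_ /eqP/negbTE li]; rewrite /preimage /mkset E0 li mul0r.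
Qed.

(** On the morphisms of [v], the block [l] evaluates [Phi (g l)] on the morphisms of the inner face
    [l]. In the row of the first vertex of that face the result is nonzero at most at its last
    vertex, so, vertex after vertex, only the outer face survives in the path sum of [f]. *)
Lemma Phi_comp r (a : 'I_r -> nat) (f : cochain k P r)
    (g : forall l, cochain k P (a l)) :
  Phi (coch_comp f g) = hoch_comp (Phi f) (fun l => Phi (g l)).
Proof.
apply: Psi_inj; rewrite PhiK; apply: funext => v.
rewrite /Psi -[RHS]/((Phi f (hoch_args _ _) : inc) _ _).
set w := outer_face v.
have w0 : v ord0 = w ord0.
  by congr (vertex v); apply: val_inj; rewrite /= offset0.
have wn : v ord_max = w ord_max.
  by congr (vertex v); apply: val_inj; rewrite /= offset_full.
have argE l : hoch_args (fun l => Phi (g l)) (simplex_mors v) l =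
    Phi (g l) (simplex_mors (inner_face v l)).
  rewrite /hoch_args; congr (hoch_fun (Phi (g l)) _); apply: funext => j.
  rewrite /simplex_mors /=; congr (inc_mor k (v _) (v _)); apply: val_inj.
    exact: RankE.
  by rewrite -[LHS]/(tagnat.Rank l j).+1 RankE -addnS.
have innerl l : inner_face v l ord0 = w (widen_ord (leqnSn r) l).
  by congr (vertex v); apply: val_inj; rewrite /= addn0.
have innerr l : inner_face v l ord_max = w (lift ord0 l).
  by congr (vertex v); apply: val_inj; rewrite /= /bump leq0n add1n offsetS.
rewrite w0 wn Phi_single_path => [|u u0 _ /prodf_neq0 nz].
  rewrite /coch_comp; congr (_ * _); apply: eq_bigr => l _.
  by rewrite argE -innerl -innerr Phi_mors.
have step (l : 'I_r) :
    u (widen_ord (leqnSn r) l) = w (widen_ord (leqnSn r) l) ->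
    u (lift ord0 l) = w (lift ord0 l).
  move=> ul; have := nz l isT; rewrite argE => /path_sum_neq0[t [t0 tn tnz]].
  by rewrite -tn -innerr; apply: (simplex_mors_path tnz); rewrite t0 ul innerl.
case=> m; elim: m => [|m IH] mr.
  by rewrite (_ : Ordinal mr = ord0) //; apply: val_inj.
have lt : (m < r)%N by [].
rewrite (_ : Ordinal mr = lift ord0 (Ordinal lt)); last exact: val_inj.
apply: step; rewrite (_ : widen_ord _ _ = Ordinal (ltnW mr)) ?IH //.
exact: val_inj.
Qed.

(** * Characterization of [Phi] and conclusion *)

Lemma Phi_is_Phi : is_Phi Phi.
Proof.
split=> [f v|n f i n0].
  have coefE x y : (Phi f v : inc) x y = (x == y)%:R * (f (point_simplex x) : k).
    case: eqVneq => [<-|ne].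
      rewrite mul1r -Phi_mors /=; congr ((hoch_fun (Phi f) _ : inc) x x).
      by apply: funext => -[].
    rewrite mul0r; apply: contraNeq ne => /path_sum_neq0[u [<- <- _]].
    by apply/eqP; congr u; exact: val_inj.
  have termE i x y : (((f (point_simplex i) : k) *: inc_mor k i i) : inc) x y =
      if (i == x) && (i == y) then f (point_simplex x) else 0.
    rewrite -[LHS]/(f (point_simplex i) *
      ([&& (i <= i)%O, x == i & y == i])%:R).
    rewrite lexx /= !(eq_sym i).
    by case: (eqVneq x i) => [->|_]; case: (eqVneq y i); rewrite ?mulr1 ?mulr0.
  split=> x y.
    apply: (@sub_finite_set _ _ [set x]%classic); last exact: finite_set1.
    by move=> i; rewrite /mkset termE; case: (i =P x) => //= _; rewrite eqxx.
  rewrite -(@fsbig_widen _ _ _ _ [set x]%classic) ?fsbig_set1 //; last first.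
    by move=> i [_ ix]; rewrite /preimage /mkset termE; case: eqP ix.
  by rewrite termE coefE eqxx /=; case: eqP; rewrite ?mul1r ?mul0r.
apply: incidence_eq => x y.
rewrite -[RHS]/(f i *
  ([&& (i ord0 <= i ord_max)%O, x == i ord0 & y == i ord_max])%:R).
rewrite simplex_mono //.
case: eqVneq => [->|xi]; last first.
  (* Since [n] is positive there is a first morphism, whose source fixes the row. *)
  rewrite mulr0; apply: contraNeq xi => /path_sum_neq0[u [<- _ /prodf_neq0 nz]].
  have := nz (Ordinal n0) isT; rewrite /= (_ : widen_ord _ _ = ord0) => [|].
    by case: and3P => [[]|]; rewrite ?eqxx.
  exact: val_inj.
case: eqVneq => [->|yi]; first by rewrite mulr1; exact: Phi_mors.
rewrite mulr0; apply: contraNeq yi => /path_sum_neq0[u [u0 <- nz]].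
by apply/eqP; exact: (simplex_mors_path nz).
Qed.

(** In degree 0 the formal sum prescribes every coefficient; in positive degree the values on
    morphisms prescribe the image under the injective [Psi]. *)
Lemma is_Phi_unique
    (Phi1 Phi2 : forall n, cochain k P n -> hochschild S n) :
  is_Phi Phi1 -> is_Phi Phi2 -> forall n, Phi1 n =1 Phi2 n.
Proof.
move=> [z1 p1] [z2 p2] [|n] f.
  apply: hochschild_eq => v; apply: incidence_eq => x y.
  by have [_ ->] := z1 f v; have [_ ->] := z2 f v.
by apply: Psi_inj; apply: funext => i; rewrite /Psi p1 // p2.
Qed.

End Phi.

Theorem corollary2p3 (k : fieldType) (k_char0 : [pchar k] =i pred0)
    (d : Order.disp_t) (P : porderType d) (lf : locally_finite P) :
  exists Phi : forall n, simplicial_hG k P n -> hochschild_hG k lf n,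
    [/\ is_Phi Phi,
        forall Psi : forall n, simplicial_hG k P n -> hochschild_hG k lf n,
          is_Phi Psi -> forall n, Psi n =1 Phi n &
        hG_isomorphism Phi].
Proof.
exists (@Phi k d P lf); split; first exact: Phi_is_Phi.
  by move=> Psi PsiP; exact: is_Phi_unique PsiP (@Phi_is_Phi k d P lf).
exact: (@operad_iso_hG_iso k (simplicial_operad_with_mul k P)
  (hochschild_operad_with_mul (identity_subalgebra k lf)) (@Phi k d P lf)
  (@Phi_linear k d P lf) (@Phi_id k d P lf) (@Phi_comp k d P lf)
  (@Phi_mul k d P lf) (@Phi_bij k d P lf)).
Qed.
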